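(* Let $\nu$ be a partition and let $r, m \in \mathbf{N}$ be positive integers. Then, in the ring of symmetric functions, \[ s_\nu \,(p_r \circ h_m) = \sum_{\lambda \,\vdash\, rm + |\nu|} \operatorname{sgn}_r(\lambda/\nu)\, s_\lambda . \]
   Context: $s_\lambda$ is the Schur function of the partition $\lambda$, $p_r$ is the power-sum symmetric function of degree $r$, $h_m = s_{(m)}$ is the complete homogeneous symmetric function of degree $m$, and $f\circ g$ denotes plethysm of symmetric functions (so $p_r \circ h_m$ is obtained from $h_m$ by replacing every variable $x_i$ with $x_i^r$). The Young diagram of $\lambda$ is $[\lambda]=\{(i,j): 1\le i\le p,\ 1\le j\le \lambda_i\}$, where $p$ is the number of parts, drawn in the English convention. The rim of $\lambda$ consists of the boxes $(i,j)\in[\lambda]$ with $(i+1,j+1)\notin[\lambda]$. A border-strip of length $s$ (an $s$-border-strip) in $\lambda$ consists of $s$ adjacent boxes in the rim of $\lambda$ whose removal from $[\lambda]$ leaves the Young diagram of a partition $\mu$; we then say $\lambda/\mu$ is an $s$-border-strip. Its height is $i-i'$, where $(i,j)$ is its bottom-left box and $(i',j')$ is its top-right box. If $\lambda/\mu$ is a border-strip of height $\ell$ then $\operatorname{sgn}(\lambda/\mu)=(-1)^\ell$. Let $\lambda/\nu$ be a skew-partition and let $d$ be minimal such that $\lambda_d>\nu_d$. An $r$-border-strip $\lambda/\mu$ is the final $r$-border-strip in $\lambda/\nu$ if $\mu/\nu$ is a skew-partition (i.e. $[\nu]\subseteq[\mu]$) and $\lambda_d>\mu_d$; it is unique if it exists.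 The skew-partition $\lambda/\nu$ is $r$-decomposable if there exist partitions $\lambda=\mu^{(0)}\supset\mu^{(1)}\supset\cdots\supset\mu^{(m)}=\nu$ such that $\mu^{(i)}/\mu^{(i+1)}$ is the final $r$-border-strip in $\mu^{(i)}/\nu$ for each $i\in\{0,\ldots,m-1\}$. In this case $\operatorname{sgn}_r(\lambda/\nu)=\operatorname{sgn}(\mu^{(0)}/\mu^{(1)})\cdots\operatorname{sgn}(\mu^{(m-1)}/\mu^{(m)})$. In all other cases (including when $[\nu]\not\subseteq[\lambda]$), $\operatorname{sgn}_r(\lambda/\nu)=0$. *)

(* Defs.v *)
From HB Require Import structures.
From mathcomp Require Import all_boot all_order all_algebra.
From mathcomp Require Import finmap multiset.
From mathcomp Require Import boolp classical_sets functions cardinality fsbigop.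

Set Implicit Arguments.
Unset Strict Implicit.
Unset Printing Implicit Defensive.

Import GRing.Theory.

Local Open Scope mset_scope.
Local Open Scope classical_set_scope.
Local Open Scope ring_scope.

(* The ring of symmetric functions is realised, as usual, inside the ring     *)
(* Z[[x_0, x_1, ...]] of formal power series in countably many variables.     *)
(* The multiset a : {mset nat} encodes the monomial \prod_i x_i ^ (a i), and  *)
(* a series is its coefficient function.                                      *)
Definition series : Type := {mset nat} -> int.

HB.instance Definition _ := gen_eqMixin series.
HB.instance Definition _ := gen_choiceMixin series.

Definition series0 : series := fun=> 0.
Definition series_add (f g : series) : series := fun a => f a + g a.
Definition series_opp (f : series) : series := fun a => - f a.
Definition series1 : series := fun a => (a == mset0)%:R.
Definition series_mul (f g : series) : series := fun a =>
  \sum_(p \in [set p : {mset nat} * {mset nat} | (p.1 `+` p.2)%mset = a])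
     f p.1 * g p.2.

Fact series_addA : associative series_add.
Proof. by move=> f g h; apply: funext => a; exact: addrA. Qed.

Fact series_addC : commutative series_add.
Proof. by move=> f g; apply: funext => a; exact: addrC. Qed.

Fact series_add0 : left_id series0 series_add.
Proof. by move=> f; apply: funext => a; exact: add0r. Qed.

Fact series_addN : left_inverse series0 series_opp series_add.
Proof. by move=> f; apply: funext => a; exact: addNr. Qed.

HB.instance Definition _ :=
  GRing.isZmodule.Build series series_addA series_addC series_add0 series_addN.

Lemma finite_msubset (a : {mset nat}) :
  finite_set [set b : {mset nat} | (b `<=` a)%mset].
Proof.
pose F (h : {ffun finsupp a -> 'I_(size a).+1}) : {mset nat} :=
  [fsfun i : finsupp a => h i : nat | 0%N].
apply: (sub_finite_set _ (finite_image F (finite_finset (X := setT)))).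
move=> b /= /msubsetP ba.
have lt i : (b i < (size a).+1)%N.
  by rewrite ltnS (leq_trans (ba i))// -count_mem_mset count_size.
exists [ffun i => Ordinal (lt (val i))] => //.
apply/fsfunP => i; rewrite fsfun_ffun; case: insubP => [u _ <-|].
  by rewrite /= ffunE.
rewrite msuppE => ai; apply/esym/eqP.
by rewrite -leqn0 (leq_trans (ba i))// leqn0 mset_eq0.
Qed.

Lemma finite_msetD (a : {mset nat}) :
  finite_set [set p : {mset nat} * {mset nat} | (p.1 `+` p.2)%mset = a].
Proof.
apply: (sub_finite_set _ (finite_setX (finite_msubset a) (finite_msubset a))).
move=> [b c] /= <-; split=> /=; apply/msubsetP => i; rewrite msetE2.
  exact: leq_addr.
exact: leq_addl.
Qed.

Lemma series_mulE (f g : series) (a : {mset nat}) (s : seq {mset nat}) :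
    uniq s -> (forall b, (b `<=` a)%mset -> b \in s) ->
  series_mul f g a = \sum_(b <- s) \sum_(c <- s | (b `+` c)%mset == a) f b * g c.
Proof.
move=> us sP; rewrite /series_mul.
pose r := [seq p <- [seq (b, c) | b <- s, c <- s] | (p.1 `+` p.2)%mset == a].
have ur : uniq r by rewrite filter_uniq// allpairs_uniq// => -[? ?] [? ?].
have -> : [set p : {mset nat} * {mset nat} | (p.1 `+` p.2)%mset = a] = [set` r].
  apply/seteqP; split=> -[b c] /=; rewrite mem_filter /=; last first.
    by case/andP => /eqP.
  move=> bca; rewrite bca eqxx; apply/allpairsP; exists (b, c).
  by split=> //=; apply: sP; rewrite -bca; apply/msubsetP => i;
    rewrite msetE2 ?leq_addr ?leq_addl.
rewrite -fsbig_seq// big_filter big_mkcond big_allpairs_dep /=.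
by apply: eq_bigr => b _; rewrite -big_mkcond.
Qed.

Lemma msubset_seq (a : {mset nat}) : exists s : seq {mset nat},
  uniq s /\ forall b, (b \in s) = (b `<=` a)%mset.
Proof.
have fa := finite_msubset a.
exists (fset_set [set b : {mset nat} | (b `<=` a)%mset]); split=> [|b]; first exact: fset_uniq.
by rewrite in_fset_set//; apply/idP/idP; rewrite inE.
Qed.

Fact series_mulC : commutative series_mul.
Proof.
move=> f g; apply: funext => a; have [s [us sP]] := msubset_seq a.
rewrite !(series_mulE _ _ us) => [|b|b]; rewrite ?sP//.
under eq_bigr do rewrite big_mkcond.
rewrite exchange_big /=; apply: eq_bigr => b _; rewrite -big_mkcond.
by apply: eq_big => [c|c _]; rewrite 1?msetDC 1?mulrC.
Qed.

Fact series_mulA : associative series_mul.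
Proof.
have tri f g h a s : uniq s -> (forall b, (b \in s) = (b `<=` a)%mset) ->
    series_mul f (series_mul g h) a = \sum_(b <- s) \sum_(c <- s)
      \sum_(d <- s | (b `+` (c `+` d))%mset == a) f b * (g c * h d).
  move=> us sP; rewrite (series_mulE _ _ us) => [|b]; rewrite ?sP//.
  apply: eq_bigr => b _.
  transitivity (\sum_(e <- s | (b `+` e)%mset == a) \sum_(c <- s)
      \sum_(d <- s | (c `+` d)%mset == e) f b * (g c * h d)).
    apply: eq_bigr => e /eqP bea; rewrite (series_mulE _ _ us) => [|c ce].
      by rewrite big_distrr; apply: eq_bigr => c _; rewrite big_distrr.
    rewrite sP (msubset_trans ce)// -bea; apply/msubsetP => i.
    by rewrite msetE2 leq_addl.
  rewrite exchange_big /=; apply: eq_bigr => c _.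
  under eq_bigr do rewrite big_mkcond.
  rewrite exchange_big /= [RHS]big_mkcond; apply: eq_bigr => d _.
  rewrite -big_mkcondr /=; case: ifPn => bcd; last first.
    by rewrite big1// => e /andP[be /eqP cde]; rewrite cde be in bcd.
  have cds : (c `+` d)%mset \in s.
    by rewrite sP -(eqP bcd); apply/msubsetP => i; rewrite [leqRHS]msetE2 leq_addl.
  rewrite big_mkcond (bigD1_seq _ cds us) /= bcd eqxx /= big1 ?addr0// => e.
  by rewrite eq_sym => /negPf->; rewrite andbF.
move=> f g h; apply: funext => a; have [s [us sP]] := msubset_seq a.
rewrite (tri _ _ _ _ _ us sP) series_mulC (tri _ _ _ _ _ us sP).
under eq_bigr do under eq_bigr do rewrite big_mkcond.
under eq_bigr do rewrite exchange_big.
rewrite exchange_big /=; apply: eq_bigr => d _; apply: eq_bigr => b _.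
rewrite [RHS]big_mkcond; apply: eq_bigr => c _.
rewrite (_ : d `+` _ = b `+` (c `+` d))%mset; last by rewrite msetDC -msetDA.
by rewrite [in RHS]mulrC -mulrA.
Qed.

Fact series_mul1 : left_id series1 series_mul.
Proof.
move=> f; apply: funext => a; have [s [us sP]] := msubset_seq a.
have in_s b : (b `<=` a)%mset -> b \in s by rewrite sP.
rewrite (series_mulE _ _ us)// (bigD1_seq mset0)//=; last first.
  by rewrite in_s//; apply/msubsetP => i; rewrite mset0E.
rewrite [X in _ + X]big1 ?addr0 => [|b /negPf b0]; last first.
  by rewrite big1// => c _; rewrite /series1 b0 mul0r.
rewrite big_mkcond (bigD1_seq a) ?in_s ?msubset_refl//= big1 => [|c /negPf ca].
  by rewrite mset0D eqxx addr0 /series1 eqxx mul1r.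
by rewrite mset0D ca.
Qed.

Fact series_mulDl : left_distributive series_mul series_add.
Proof.
move=> f g h; apply: funext => a; have [s [us sP]] := msubset_seq a.
rewrite /series_add !(series_mulE _ _ us) => [|b|b|b]; rewrite ?sP//.
rewrite -big_split; apply: eq_bigr => b _; rewrite -big_split.
by apply: eq_bigr => c _; rewrite mulrDl.
Qed.

Fact series1_neq0 : series1 != series0.
Proof.
by apply/eqP => /(congr1 (fun f : series => f mset0)); rewrite /series1 eqxx.
Qed.

HB.instance Definition _ := GRing.Zmodule_isComNzRing.Build series
  series_mulA series_mulC series_mul1 series_mulDl series1_neq0.

(* Partitions, and boxes with 0-based coordinates: (i, j) is the box in row i *)
(* (counted from the top) and column j.                                       *)
Definition is_part (la : seq nat) : bool := sorted geq la && (0%N \notin la).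

Lemma finite_part (n : nat) :
  finite_set [set la : seq nat | is_part la /\ sumn la = n].
Proof.
pose F (u : {k : 'I_n.+1 & k.-tuple 'I_n.+1}) : seq nat :=
  [seq val i | i <- tagged u].
apply: (sub_finite_set _ (finite_image F (finite_finset (X := setT)))).
move=> la [/andP[_ la0] lan].
have le_la i : i \in la -> (i < n.+1)%N.
  by move=> /perm_to_rem/perm_sumn/= lai; rewrite ltnS -lan lai leq_addr.
have lt_la : (size la < n.+1)%N.
  rewrite ltnS -lan; elim: la la0 {lan le_la} => //= i la IH.
  by rewrite inE negb_or eq_sym -lt0n => /andP[i0 /IH le_la]; rewrite -add1n leq_add.
have sz : size [seq (inord i : 'I_n.+1) | i <- la] == Ordinal lt_la.
  by rewrite size_map.
exists (Tagged (fun k : 'I_n.+1 => k.-tuple 'I_n.+1) (Tuple sz)) => //.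
rewrite /F /= -map_comp -[RHS]map_id; apply/eq_in_map => i /le_la lt_i.
by rewrite /= inordK.
Qed.

Definition box : Type := (nat * nat)%type.

Definition diagram (la : seq nat) : seq box :=
  [seq (i, j) | i <- iota 0 (size la), j <- iota 0 (nth 0%N la i)].

Definition subdiagram (mu la : seq nat) : bool :=
  all (fun b => b \in diagram la) (diagram mu).

Definition semistandard (la : seq nat)
    (T : {ffun seq_sub (diagram la) -> nat}) : bool :=
  [forall b, forall c,
     (((ssval b).1 == (ssval c).1) && ((ssval b).2 <= (ssval c).2)%N
        ==> (T b <= T c)%N)
  && (((ssval b).2 == (ssval c).2) && ((ssval b).1 < (ssval c).1)%N
        ==> (T b < T c)%N)].

(* s_la = \sum_T x^T over the semistandard tableaux T of shape la: the        *)
(* coefficient at a is the number of those whose multiset of entries is a.    *)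
Definition schur (la : seq nat) : series := fun a =>
  \sum_(T \in [set T : {ffun seq_sub (diagram la) -> nat} |
                 semistandard T /\ seq_mset (codom T) = a]) (1 : int).

Lemma finite_tableaux (la : seq nat) (a : {mset nat}) :
  finite_set [set T : {ffun seq_sub (diagram la) -> nat} |
                semistandard T /\ seq_mset (codom T) = a].
Proof.
pose n := (\max_(i <- a) i)%N.
pose F (h : {ffun seq_sub (diagram la) -> 'I_n.+1}) :
  {ffun seq_sub (diagram la) -> nat} := [ffun b => h b : nat].
apply: (sub_finite_set _ (finite_image F (finite_finset (X := setT)))).
move=> T [_ Ta]; exists [ffun b => inord (T b)] => //.
apply/ffunP => b; rewrite !ffunE inordK// ltnS.
have : T b \in (a : seq nat).
  by rewrite -Ta (perm_mem (perm_eq_seq_mset _)) codom_f.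
by move=> Tb; exact: (@leq_bigmax_seq _ _ xpredT id).
Qed.

Definition complete (m : nat) : series := schur [:: m].

(* p_r \o f, that is f (x_0 ^ r, x_1 ^ r, ...), for r > 0: x^b is sent to     *)
(* x^a with a = r b.                                                          *)
Definition power_plethysm (r : nat) (f : series) : series := fun a =>
  \sum_(b \in [set b : {mset nat} | forall i, a i = (r * b i)%N]) f b.

Lemma finite_root (r : nat) (a : {mset nat}) : (0 < r)%N ->
  finite_set [set b : {mset nat} | forall i, a i = (r * b i)%N].
Proof.
move=> r0; apply: (sub_finite_set _ (finite_msubset a)) => b /= ab.
by apply/msubsetP => i; rewrite ab leq_pmull.
Qed.

Definition rim (la : seq nat) : seq box :=
  [seq b <- diagram la | (b.1.+1, b.2.+1) \notin diagram la].

Definition skew_boxes (la mu : seq nat) : seq box :=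
  [seq b <- diagram la | b \notin diagram mu].

Definition adjacent (b c : box) : bool :=
     (b.1 == c.1) && ((b.2 == c.2.+1) || (c.2 == b.2.+1))
  || (b.2 == c.2) && ((b.1 == c.1.+1) || (c.1 == b.1.+1)).

Definition connected (B : seq box) : bool :=
  [forall b : seq_sub B, forall c : seq_sub B,
     connect (fun x y => adjacent (ssval x) (ssval y)) b c].

Definition border_strip (s : nat) (la mu : seq nat) : bool :=
  [&& is_part mu, subdiagram mu la, size (skew_boxes la mu) == s,
      all (fun b => b \in rim la) (skew_boxes la mu)
    & connected (skew_boxes la mu)].

Definition bottom_left (B : seq box) : box :=
  head (0, 0)%N [seq b <- B | all (fun c => (c.1 <= b.1)%N && (b.2 <= c.2)%N) B].

Definition top_right (B : seq box) : box :=
  head (0, 0)%N [seq b <- B | all (fun c => (b.1 <= c.1)%N && (c.2 <= b.2)%N) B].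

Definition height (la mu : seq nat) : nat :=
  ((bottom_left (skew_boxes la mu)).1 - (top_right (skew_boxes la mu)).1)%N.

Definition strip_sgn (la mu : seq nat) : int := (-1) ^+ height la mu.

(* The least d such that nu_d < la_d. *)
Definition first_row (la nu : seq nat) : nat :=
  find (fun i => (nth 0%N nu i < nth 0%N la i)%N) (iota 0 (size la)).

Definition final_strip (r : nat) (nu la mu : seq nat) : bool :=
  [&& border_strip r la mu, subdiagram nu mu
    & (nth 0%N mu (first_row la nu) < nth 0%N la (first_row la nu))%N].

(* With la = mu^(0), c lists mu^(1), ..., mu^(m) = nu.                        *)
Definition decomposition (r : nat) (la nu : seq nat) (c : seq (seq nat)) :
    bool :=
  path (final_strip r nu) la c && (last la c == nu).

Definition decomposition_sgn (la : seq nat) (c : seq (seq nat)) : int :=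
  \prod_(p <- zip (la :: c) c) strip_sgn p.1 p.2.

(* Final strips are unique when they exist, hence so is a decomposition and   *)
(* the choice made by xchoose is immaterial.                                  *)
Definition sgn_r (r : nat) (la nu : seq nat) : int :=
  match pselect (exists c, decomposition r la nu c) with
  | left ex => decomposition_sgn la (xchoose ex)
  | right _ => 0
  end.

(* Main.v *)
Require Import Defs.
From mathcomp Require Import all_boot all_order all_fingroup all_algebra.
From mathcomp Require Import finmap multiset.
From mathcomp Require Import boolp classical_sets functions cardinality fsbigop.
From mathcomp Require Import zify.

(* Work in N variables x_0, ..., x_(N-1) with N large, and encode a partition *)
(* by its beta numbers la_i + N - 1 - i. Let a_b = det (x_i ^ (b_j)). Peeling *)
(* off the last variable shows that tableaux and alternants obey the same     *)
(* recursion, so a_(la + delta) = s_la a_delta. Since p_r o h_m is the sum of *)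
(* the monomials x^(r beta) with |beta| = m, antisymmetry gives               *)
(*   a_b (p_r o h_m) = \sum_c det M(b, c) a_c                                 *)
(* over the decreasing sequences c of the right weight, where M(b, c)_(i j)   *)
(* is 1 if c_i is obtained from b_j by adding a multiple of r, and 0          *)
(* otherwise. It remains to see that sgn_r(la / nu) is this determinant: if   *)
(* c_d is the largest bead of la that is not the corresponding bead of nu,    *)
(* then row d of M is unchanged when c_d is replaced by c_d - r. So the       *)
(* determinant vanishes unless this move is possible; the move removes the    *)
(* final r-border-strip, and sorting the beads again yields its sign.         *)
(* Division by a_delta is possible because every x_i - x_j with i <> j is     *)
(* regular in the ring of series.                                             *)

Set Implicit Arguments.
Unset Strict Implicit.
Unset Printing Implicit Defensive.

Import GRing.Theory.

(** * Partitions and diagrams *)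

(** The coefficient of a given monomial involves only finitely many variables, and there Schur
    functions are quotients of alternants ([bialternant]). Multiplying an alternant by p_r o h_m
    adds multiples of r to its exponents. By antisymmetry the results can be collected on decreasing
    exponent sequences c, each with coefficient the determinant of the 0-1 matrix [move_mx]
    ([alternant_pieri]). All the combinatorics then lies in [sgn_r_det], which identifies this
    determinant with the sign.

    On the beads, removing an r-border-strip lowers one bead by r into a vacant position, and the
    height of the strip is the number of beads jumped over. The final strip must start in the first
    row d where la exceeds nu, and there c_d is not a bead of nu. An entry of row d tells whether
    c_d can be reached from b_j by steps of length r; since c_d differs from b_j, the last step can
    be undone, so the row does not change when c_d is lowered by r ([det_move_step]). If the lowered
    bead would be negative, the row is zero; if its place is taken, two rows coincide
    ([det_move_neq0]); if the new partition does not contain nu, the determinant is zero by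
    [det_move_eq0]. Otherwise a final strip exists ([final_strip_ex]), and moving the row to its
    sorted place costs the sign of the strip ([final_stripP]). The recursion ends at la = nu with a
    unitriangular matrix.

    The Vandermonde factor is cancelled by [part_alternant_lreg] and [Xvar_sub_lreg]; the return to
    infinitely many variables rests on [eq_series_mul], [schur_tableau_sum] and
    [power_plethysm_complete]. *)

Lemma geq_trans : transitive geq.
Proof. by move=> m n p mn pm; exact: leq_trans pm mn. Qed.

Lemma mem_diagram la i j : ((i, j) \in diagram la) = (j < nth 0 la i).
Proof.
apply/allpairsPdep/idP => [[k [l [_ + [-> ->]]]]|ji].
  by rewrite mem_iota.
exists i, j; rewrite !mem_iota /= add0n; split=> //.
by rewrite ltnNge; apply: contraTN ji => /(nth_default 0) ->.
Qed.

Lemma diagram_uniq la : uniq (diagram la).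
Proof.
apply: allpairs_uniq_dep => [|i _|]; rewrite ?iota_uniq//.
by move=> [i j] [k l] /= _ _ [-> ->].
Qed.

Lemma is_part_nth la i j : is_part la -> i <= j -> nth 0 la j <= nth 0 la i.
Proof.
case/andP => sla _ ij; case: (ltnP j (size la)) => [jla|/(nth_default 0) ->//].
by apply: (sorted_leq_nth geq_trans leqnn _ sla) => //; rewrite inE//; lia.
Qed.

Lemma is_part_size la i : is_part la -> (i < size la) = (0 < nth 0 la i).
Proof.
case/andP => _ la0; case: ltnP => [ila|/(nth_default 0) ->//].
by rewrite lt0n; apply/esym; apply: contra la0 => /eqP <-; exact: mem_nth.
Qed.

Lemma is_part_inj la mu :
  is_part la -> is_part mu -> nth 0 la =1 nth 0 mu -> la = mu.
Proof.
move=> pla pmu eq_lm; apply: (@eq_from_nth _ 0) => // .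
apply/eqP; rewrite eqn_leq; apply/andP; split; rewrite leqNgt.
  by rewrite is_part_size// eq_lm -is_part_size// ltnn.
by rewrite is_part_size// -eq_lm -is_part_size// ltnn.
Qed.

(** Row lengths given by a formula on a fixed number of rows may end in zeros, which [is_part]
    forbids. For a sorted sequence the deletion is invisible to [nth 0]. *)
Definition strip_zeros (la : seq nat) : seq nat := [seq i <- la | 0 < i].

Lemma nth_strip_zeros la i :
  sorted geq la -> nth 0 (strip_zeros la) i = nth 0 la i.
Proof.
rewrite /strip_zeros; elim: la i => [|k la IH] i //= kla.
case: (posnP k) => [k0|k_gt0]; last by case: i => //= i; apply/IH/path_sorted/kla.
have la0 j : j \in la -> j = 0%N.
  have /allP h := order_path_min geq_trans kla.
  by move=> /h /=; rewrite k0; case: j.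
have -> : [seq x <- la | 0 < x] = [::].
  by apply/eqP; rewrite -[_ == _]negbK -has_filter; apply/hasPn => j /la0 ->.
rewrite nth_nil k0; case: i => //= i; apply/esym.
by case: (ltnP i (size la)) => [ila|/(nth_default 0) ->//]; apply/la0/mem_nth.
Qed.

Lemma is_part_strip_zeros la : sorted geq la -> is_part (strip_zeros la).
Proof.
move=> sla; rewrite /is_part mem_filter ltnn /= andbT.
exact: (sorted_filter geq_trans).
Qed.

Lemma subdiagramP mu la :
  reflect (forall i, nth 0 mu i <= nth 0 la i) (subdiagram mu la).
Proof.
apply: (iffP allP) => [sub i|le [i j]]; last first.
  by rewrite !mem_diagram => /leq_trans; apply.
case E: (nth 0 mu i) => [//|k].
by have := sub (i, k); rewrite !mem_diagram E; apply.
Qed.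

Lemma mem_skew la mu i j :
  ((i, j) \in skew_boxes la mu) = (nth 0 mu i <= j < nth 0 la i).
Proof. by rewrite mem_filter !mem_diagram -leqNgt. Qed.

Lemma sumn_nth n la : size la <= n -> sumn la = \sum_(i < n) nth 0 la i.
Proof.
elim: la n => [|k la IH] [|n]//=; first by rewrite big_ord0.
  by rewrite big1// => i _; rewrite nth_nil.
by rewrite ltnS => /IH ->; rewrite big_ord_recl.
Qed.

Lemma big_diagram (R : Type) (idx : R) (op : Monoid.com_law idx) la n (F : box -> R) :
  size la <= n ->
  \big[op/idx]_(b <- diagram la) F b =
  \big[op/idx]_(i < n) \big[op/idx]_(0 <= j < nth 0 la i) F (val i, j).
Proof.
move=> lan; rewrite /diagram big_allpairs_dep -{1}[size la]subn0.
rewrite -/(index_iota 0 (size la)) big_mkord (big_ord_widen _ (fun i =>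
  \big[op/idx]_(j <- iota 0 (nth 0 la i)) F (i, j)) lan) big_mkcond.
apply: eq_bigr => i _; rewrite /index_iota subn0.
by case: ltnP => // /(nth_default 0) ->; rewrite big_nil.
Qed.

Lemma size_diagram la : size (diagram la) = sumn la.
Proof.
rewrite (sumn_nth (leqnn _)) -sum1_size (big_diagram _ _ (leqnn _)).
by apply: eq_bigr => i _; rewrite sum_nat_const_nat muln1 subn0.
Qed.

Lemma size_skew la mu :
  subdiagram mu la -> (size (skew_boxes la mu) + sumn mu)%N = sumn la.
Proof.
move=> /allP sub; rewrite -[sumn la]size_diagram -[sumn mu]size_diagram.
rewrite size_filter -(count_predC (fun b => b \in diagram mu) (diagram la)) addnC.
congr (_ + _); rewrite -size_filter; apply/perm_size/uniq_perm => [||b].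
- exact: diagram_uniq.
- by rewrite filter_uniq// diagram_uniq.
by rewrite mem_filter; case: (boolP (b \in diagram mu)) => // /sub ->.
Qed.

(** * Determinants of bead moves *)

Definition beta (n : nat) (la : seq nat) (i : nat) : nat :=
  (nth 0 la i + (n - i.+1))%N.

Lemma beta_decr n la i j :
  is_part la -> i < j -> j < n -> beta n la j < beta n la i.
Proof.
by move=> pla ij jn; have := is_part_nth pla (ltnW ij); rewrite /beta; lia.
Qed.

Section MoveDet.
Variable r : nat.

Definition move_mx n (b c : nat -> nat) : 'M[int]_n :=
  \matrix_(i, j) ((b j <= c i)%N && (r %| c i - b j)%N)%:R%R.

(** Every term of the Leibniz expansion vanishes: by counting, a permutation s cannot send all
    indices i >= k beyond k, so some i >= k has s i <= k, and then c_i <= c_k < b_k <= b_(s i). *)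
Lemma det_move_eq0 n (b c : nat -> nat) k : k < n ->
  (forall i j, i < j -> j < n -> b j < b i) ->
  (forall i j, i < j -> j < n -> c j < c i) ->
  c k < b k -> (\det (move_mx n b c) = 0)%R.
Proof.
move=> kn bdecr cdecr ckbk.
apply: big1 => s _.
have [i ki sik] : exists2 i : 'I_n, k <= i & s i <= k.
  apply/exists_inP; apply: contraT; rewrite negb_exists => /forallP none.
  pose A := [set i : 'I_n | k <= i]; pose B := [set i : 'I_n | k < i].
  have : #|A| <= #|B|.
    rewrite -(card_imset _ (@perm_inj _ s)); apply/subset_leq_card/fintype.subsetP.
    move=> _ /imsetP[i + ->]; rewrite !inE => ki; have := none i.
    by rewrite ki -ltnNge.
  rewrite leqNgt proper_card//; apply/properP; split.
    by apply/fintype.subsetP => i; rewrite !inE; exact: ltnW.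
  by exists (Ordinal kn); rewrite !inE /= ?ltnn.
have bb : b k <= b (s i).
  by move: sik; rewrite leq_eqVlt => /predU1P[->//|h]; exact/ltnW/bdecr.
have cc : c i <= c k.
  by move: ki; rewrite leq_eqVlt => /predU1P[->//|h]; exact/ltnW/cdecr.
rewrite (bigD1 i)//= mxE leqNgt (leq_ltn_trans cc (leq_trans ckbk bb)) /=.
by rewrite mul0r mulr0.
Qed.

Lemma det_move_refl n (b : nat -> nat) :
  (forall i j, i < j -> j < n -> b j < b i) -> (\det (move_mx n b b) = 1)%R.
Proof.
move=> bdecr; rewrite -det_tr det_trig; last first.
  apply/is_trig_mxP => i j ij; rewrite !mxE.
  by rewrite leqNgt bdecr.
by apply: big1 => i _; rewrite !mxE leqnn subnn dvdn0.
Qed.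

(** The only case in question is c < b < c + r, where c + r - b lies strictly between 0 and r and so
    is not a multiple of r. *)
Lemma move_entry_sub (b c : nat) : c + r != b ->
  (b <= c + r) && (r %| c + r - b) = (b <= c) && (r %| c - b).
Proof.
move=> cb; case: (leqP b c) => [bc|cb'] /=.
  by rewrite (leq_trans bc) ?leq_addr//= addnC -addnBA// dvdn_addr.
apply/negP => /andP[bcr]; rewrite gtnNdvd//; lia.
Qed.

(* A row of [move_mx n b c] depends on its bead [c d] only modulo [r] as long *)
(* as the bead moves down through positions that are not beads of [b].        *)
Lemma det_move_step n (b c c' : nat -> nat) (d e : 'I_n.+1) :
  c d = c' e + r -> (forall j : 'I_n.+1, c d != b j) ->
  (forall i : 'I_n, c (lift d i) = c' (lift e i)) ->
  (\det (move_mx n.+1 b c) = (-1) ^+ (d + e) * \det (move_mx n.+1 b c'))%R.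
Proof.
(* The two rows used for the expansions agree by [move_entry_sub], and the complementary minors
   involve the same beads; only the cofactor signs differ. *)
move=> cd cdb cl; rewrite (expand_det_row _ d) (expand_det_row _ e) big_distrr.
apply: eq_bigr => j _; rewrite !mxE cd move_entry_sub -?cd//.
have -> : cofactor (move_mx n.+1 b c) d j =
    ((-1) ^+ (d + e) * cofactor (move_mx n.+1 b c') e j)%R.
  rewrite /cofactor mulrA -exprD -signr_odd -[in RHS]signr_odd !oddD.
  have -> : odd d (+) odd e (+) (odd e (+) odd j) = odd d (+) odd j.
    by case: (odd d) (odd e) (odd j) => -[] [].
  congr (_ * \det _)%R.
  by apply/matrixP => k l; rewrite !mxE cl.
by rewrite mulrCA.
Qed.

(** A blocked move kills the determinant. If c_d < r, no difference c_d - b_j can be a positive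
    multiple of r, so row d is zero; if c_i = c_d - r, rows d and i are equal. *)
Lemma det_move_neq0 n (b c : nat -> nat) (d : 'I_n) : 0 < r ->
  (forall j : 'I_n, c d != b j) -> (\det (move_mx n b c) != 0)%R ->
  r <= c d /\ forall i : 'I_n, c i != c d - r.
Proof.
move=> r_gt0 cdb det0; have rcd : r <= c d.
  rewrite leqNgt; apply: contra_neqN det0 => cdr.
  rewrite (expand_det_row _ d) big1// => j _; rewrite mxE.
  case: leqP => /= [bj|_]; last by rewrite mul0r.
  by rewrite gtnNdvd ?mul0r//; have := cdb j; lia.
split=> // i; apply: contra_neq det0 => ci.
apply: (@determinant_alternate _ _ _ d i).
  by apply: contra_eq_neq ci => <-; lia.
move=> j; rewrite !mxE ci -(@move_entry_sub (b j) (c d - r)) ?subnK//.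
Qed.

End MoveDet.

(** * Border strips in terms of row lengths *)

Lemma adjacentP b c :
  adjacent b c <->
     b.1 = c.1 /\ (b.2 = c.2.+1 \/ c.2 = b.2.+1)
  \/ b.2 = c.2 /\ (b.1 = c.1.+1 \/ c.1 = b.1.+1).
Proof.
split=> [/orP[]/andP[/eqP? /orP[]/eqP?]|]; try by intuition.
by rewrite /adjacent => -[] [-> [] ->]; rewrite !eqxx ?orbT.
Qed.

Lemma skew_head (B : seq box) (p : pred box) b :
  b \in B -> p b -> p (head (0, 0)%N [seq c <- B | p c]) /\
  head (0, 0)%N [seq c <- B | p c] \in B.
Proof.
move=> bB pb; have : b \in [seq c <- B | p c] by rewrite mem_filter pb.
case E: [seq _ <- _ | _] => [|c s] // _.
by move: (mem_head c s); rewrite -{1}E mem_filter => /andP[].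
Qed.

(** Connectedness makes consecutive rows of the strip share at least one column, and lying in the
    rim allows at most one. Hence the equality between rows i and i + 1. *)
Lemma border_strip_rows r la mu : 0 < r -> is_part la -> border_strip r la mu ->
  exists d e, [/\ d <= e, nth 0 mu d < nth 0 la d,
    forall i, i < d \/ e < i -> nth 0 la i = nth 0 mu i,
    forall i, d <= i < e -> nth 0 la i.+1 = (nth 0 mu i).+1
    & height la mu = (e - d)%N].
Proof.
move=> r_gt0 pla /and5P[pmu /subdiagramP sub /eqP sz /allP inrim conn].
have ex : exists i, nth 0 mu i < nth 0 la i.
  case E: (skew_boxes la mu) => [|[i j] s]; first by move: sz r_gt0; rewrite E => <-.
  exists i; have := mem_head (i, j) s; rewrite -E mem_skew.
  by case/andP; exact: leq_ltn_trans.
have bnd i : nth 0 mu i < nth 0 la i -> i <= size la.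
  by move=> h; rewrite ltnW// is_part_size//; lia.
case: (ex_minnP ex) => d mu_d d_min; case: (ex_maxnP ex bnd) => e mu_e e_max.
have de : d <= e by exact: d_min.
exists d, e.
have out i : i < d \/ e < i -> nth 0 la i = nth 0 mu i.
  move=> ie; apply/eqP; rewrite eqn_leq sub andbT leqNgt; apply/negP => h.
  by have := d_min _ h; have := e_max _ h; lia.
have Brow b : b \in skew_boxes la mu -> d <= b.1 <= e.
  case: b => i j; rewrite mem_skew => /andP[h1 h2].
  have h := leq_ltn_trans h1 h2.
  by rewrite d_min//= e_max.
have overlap i : d <= i < e -> nth 0 mu i < nth 0 la i.+1.
  move=> /andP[di ie]; rewrite ltnNge; apply/negP => no.
  have Bd : (d, nth 0 mu d) \in skew_boxes la mu by rewrite mem_skew leqnn.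
  have Be : (e, nth 0 mu e) \in skew_boxes la mu by rewrite mem_skew leqnn.
  have /forallP/(_ (SeqSub Bd))/forallP/(_ (SeqSub Be)) := conn.
  (* Without a common column of rows i and i + 1, this set of boxes is closed under adjacency; it
     contains the chosen box of row d and not that of row e. *)
  pose a := [pred b : seq_sub (skew_boxes la mu) | (ssval b).1 <= i].
  move/(closed_connect (a := a)); rewrite !inE /= di leqNgt ie => h.
  suff: true = ~~ true by [].
  apply: h => -[[i1 j1] B1] [[i2 j2] B2] /adjacentP /=.
  have := B1; have := B2; rewrite !mem_skew !inE /= => C2 C1.
  case=> [[-> //]|[jj ii]]; subst j2.
  by case: ii => ii; have [?|?] := eqVneq i1 i; have [?|?] := eqVneq i2 i;
    try lia; subst; lia.
split=> // [i /andP[di ie]|].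
  have lt_i : nth 0 mu i < nth 0 la i.
    by apply: leq_trans (is_part_nth pla (leqnSn i)); apply: overlap; rewrite di.
  have : (i, nth 0 mu i) \in rim la by apply: inrim; rewrite mem_skew leqnn.
  rewrite mem_filter /= => /andP[]; rewrite mem_diagram -leqNgt => h _.
  by have := overlap i; rewrite di ie => /(_ isT); lia.
have Be : (e, nth 0 mu e) \in skew_boxes la mu by rewrite mem_skew leqnn.
have Bd : (d, (nth 0 la d).-1) \in skew_boxes la mu.
  by rewrite mem_skew; lia.
rewrite /height /bottom_left /top_right.
set p := (fun b => all _ _); set q := (fun b => all _ _).
have pe : p (e, nth 0 mu e).
  apply/allP => -[i j] Bb; have := Brow _ Bb => /= /andP[_ ie].
  rewrite ie /=; move: Bb; rewrite mem_skew => /andP[h _].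
  exact: leq_trans (is_part_nth pmu ie) h.
have qd : q (d, (nth 0 la d).-1).
  apply/allP => -[i j] Bb; have := Brow _ Bb => /= /andP[id _].
  rewrite id /=; move: Bb; rewrite mem_skew => /andP[_ h].
  by have := is_part_nth pla id; lia.
have [/allP p1 p2] := skew_head Be pe; have [/allP q1 q2] := skew_head Bd qd.
have /andP[/= p3 _] := p1 _ Be; have /andP[/= q3 _] := q1 _ Bd.
have := Brow _ p2; have := Brow _ q2.
set x := head _ _; set y := head _ _ => hx hy.
have -> : x.1 = d by apply/eqP; rewrite eqn_leq q3; case/andP: hx.
by have -> : y.1 = e by apply/eqP; rewrite eqn_leq p3 andbT; case/andP: hy.
Qed.

(** Converse of [border_strip_rows]. For connectedness, each box is joined to the bottom-left one by
    going left along its row, and down when at the left end. *)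
Lemma border_strip_intro la mu d e : is_part la -> is_part mu -> d <= e ->
  (forall i, i < d \/ e < i -> nth 0 la i = nth 0 mu i) ->
  (forall i, d <= i < e -> nth 0 la i.+1 = (nth 0 mu i).+1) ->
  nth 0 mu e < nth 0 la e ->
  border_strip (sumn la - sumn mu) la mu.
Proof.
move=> pla pmu de out strip mue.
have lt_row i : d <= i <= e -> nth 0 mu i < nth 0 la i.
  case/andP => di; rewrite leq_eqVlt => /predU1P[->//|ie].
  by have := is_part_nth pla (leqnSn i); rewrite strip ?di.
have sub : subdiagram mu la.
  apply/subdiagramP => i; have [die|die] := boolP (d <= i <= e).
    exact/ltnW/lt_row.
  by rewrite out//; lia.
have Brow i j : (i, j) \in skew_boxes la mu -> d <= i <= e.
  rewrite mem_skew => h; apply: contraT => die.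
  by move: h; rewrite out; lia.
apply/and5P; split=> //.
- by rewrite -(size_skew sub) addnK.
- apply/allP => -[i j] Bb; have := Brow _ _ Bb; move: Bb.
  rewrite !mem_filter !mem_diagram /= -!leqNgt => /andP[h ->] /andP[di ie].
  rewrite andbT; move: ie; rewrite leq_eqVlt => /predU1P[ie|ie].
    rewrite {}ie in h di *; rewrite out; last by right.
    by have := is_part_nth pmu (leqnSn e); lia.
  by rewrite strip ?di// ltnS.
set R := (fun x y : seq_sub (skew_boxes la mu) => adjacent (ssval x) (ssval y)).
have Be : (e, nth 0 mu e) \in skew_boxes la mu by rewrite mem_skew leqnn.
have to_e n (x : seq_sub (skew_boxes la mu)) :
    (e - (ssval x).1 + (ssval x).2 <= n)%N -> connect R x (SeqSub Be).
  elim: n x => [|n IH] [[i j] Bb] /= le_n.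
    suff E : (i, j) = (e, nth 0 mu e).
      by apply: eq_connect0; apply: val_inj.
    have h := Brow _ _ Bb; have h' := Bb; rewrite mem_skew in h'.
    have ie : i = e by lia.
    by rewrite ie in h' le_n *; congr (_, _); lia.
  have die := Brow _ _ Bb; have := Bb; rewrite mem_skew => /andP[mj jl].
  move: mj; rewrite leq_eqVlt => /predU1P[jE|mj].
    have [ie|ie] := eqVneq i e; first by apply: eq_connect0; apply: val_inj => /=; rewrite -jE ie.
    have By : (i.+1, j) \in skew_boxes la mu.
      rewrite mem_skew -jE strip ?ltnSn ?andbT; last by lia.
      exact: is_part_nth.
    apply: (@connect_trans _ _ (SeqSub By)); last by apply: IH => /=; lia.
    by apply/connect1/adjacentP; right; split=> //; right.
  have By : (i, j.-1) \in skew_boxes la mu by rewrite mem_skew; lia.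
  apply: (@connect_trans _ _ (SeqSub By)); last by apply: IH => /=; lia.
  by apply/connect1/adjacentP => /=; left; split=> //; left; lia.
have symR : connect_sym R.
  apply: sym_connect_sym => x y; apply/idP/idP => /adjacentP h; apply/adjacentP;
    move: h; by intuition.
apply/forallP => x; apply/forallP => y.
apply: connect_trans (to_e _ _ (leqnn _)) _.
by rewrite symR; exact: to_e (leqnn _).
Qed.

(** * The sign as a determinant *)

Lemma before_first_row la nu i : i < first_row la nu -> nth 0 la i <= nth 0 nu i.
Proof.
move=> i_lt; have : i < size la.
  by apply: leq_trans i_lt _; rewrite -[X in _ <= X](size_iota 0) find_size.
by move=> ila; have := before_find 0 i_lt; rewrite nth_iota// add0n ltnNge => /negbFE.
Qed.

Lemma first_row_eq la nu d : nth 0 nu d < nth 0 la d ->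
  (forall i, i < d -> nth 0 la i <= nth 0 nu i) -> first_row la nu = d.
Proof.
move=> lt_d before; apply/eqP; rewrite eqn_leq; apply/andP; split; rewrite leqNgt; apply/negP.
  by move/before_first_row; rewrite leqNgt lt_d.
move=> fd; have d_la : d < size la.
  by rewrite ltnNge; apply: contraTN lt_d => /(nth_default 0) ->.
have : has (fun i => nth 0 nu i < nth 0 la i) (iota 0 (size la)).
  by apply/hasP; exists d; rewrite ?mem_iota.
move/(nth_find 0); rewrite -/(first_row la nu) nth_iota ?add0n.
  by rewrite ltnNge before.
exact: ltn_trans d_la.
Qed.

(** Rows d, ..., e - 1 of mu are rows d + 1, ..., e of la less one box, and the staircase makes up
    for this box. So the strip changes a single bead, of rank d before and e after. *)
Lemma beta_lift n la mu (d e : 'I_n.+1) : d <= e ->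
  (forall i, i < d \/ e < i -> nth 0 la i = nth 0 mu i) ->
  (forall i, d <= i < e -> nth 0 la i.+1 = (nth 0 mu i).+1) ->
  forall i : 'I_n, beta n.+1 la (lift d i) = beta n.+1 mu (lift e i).
Proof.
move=> de out strip i; rewrite /beta /= /bump.
have := ltn_ord i; case: (leqP d i) => di; case: (leqP e i) => ei /=; rewrite ?add1n ?add0n => lt_i.
- by rewrite out//; right.
- by rewrite strip ?di//; lia.
- by lia.
- by rewrite out//; left.
Qed.

Lemma sum_beta n la : size la <= n ->
  \sum_(i < n) beta n la i = (sumn la + \sum_(i < n) (n - i.+1))%N.
Proof. by move=> lan; rewrite big_split /= -sumn_nth. Qed.

(** The beads add up to the size of the partition plus a constant, so the moved bead falls by the
    number of boxes removed. *)
Lemma sumn_beta_lift n la mu (d e : 'I_n.+1) :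
  size la <= n.+1 -> size mu <= n.+1 ->
  (forall i : 'I_n, beta n.+1 la (lift d i) = beta n.+1 mu (lift e i)) ->
  (sumn la + beta n.+1 mu e = sumn mu + beta n.+1 la d)%N.
Proof.
move=> lan mun lift_eq; have := sum_beta lan; have := sum_beta mun.
have D1 (c : nat -> nat) (k : 'I_n.+1) :
  \sum_(i < n.+1) c i = (c k + \sum_(i < n) c (lift k i))%N by exact: bigD1_ord.
rewrite (D1 _ e) (D1 _ d) (eq_bigr _ (fun i _ => lift_eq i)).
set S := \sum_(i < n) _; set T := \sum_(i < _) _ => h1 h2.
suff : (sumn la + beta n.+1 mu e + (S + T) = sumn mu + beta n.+1 la d + (S + T))%N.
  exact: addIn.
by move: h1 h2; clearbody S T; lia.
Qed.

Lemma sub_size mu la : is_part mu -> subdiagram mu la -> size mu <= size la.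
Proof.
move=> pmu /subdiagramP sub; rewrite leqNgt; apply/negP; rewrite is_part_size//.
by move=> h; have := leq_trans h (sub _); rewrite nth_default.
Qed.

Lemma final_stripP n r nu la mu : 0 < r -> is_part nu -> is_part la ->
  size la <= n.+1 -> final_strip r nu la mu ->
  [/\ is_part mu, size mu <= n.+1, sumn mu < sumn la &
   (\det (move_mx r n.+1 (beta n.+1 nu) (beta n.+1 la)) =
    strip_sgn la mu * \det (move_mx r n.+1 (beta n.+1 nu) (beta n.+1 mu)))%R].
Proof.
move=> r_gt0 pnu pla lan /and3P[bs /subdiagramP numu mu_f].
have [d [e [de mud out strip hgt]]] := border_strip_rows r_gt0 pla bs.
have /and5P[pmu mula /eqP sz _ _] := bs; have := size_skew mula; rewrite sz => sum_eq.
have mu_e : nth 0 mu e < nth 0 la e.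
  move: de; rewrite leq_eqVlt => /predU1P[<-//|de].
  case: e de strip {out hgt} => // e de strip.
  by rewrite strip ?ltnS ?leqnn ?andbT//; apply: is_part_nth.
have en : e < n.+1.
  by apply: leq_trans lan; rewrite is_part_size//; lia.
have mun : size mu <= n.+1 by apply: leq_trans lan; apply: sub_size.
(* Above row d nothing is removed, so [first_row] is not above d; in row d, la is longer than mu and
   hence than nu. *)
have fd : first_row la nu = d.
  apply/eqP; rewrite eqn_leq; apply/andP; split; rewrite leqNgt; apply/negP.
    by move/before_first_row; have := numu d; lia.
  by move=> h; rewrite out ?ltnn// in mu_f; left.
pose d' := Ordinal (leq_ltn_trans de en); pose e' := Ordinal en.
have lift_eq := @beta_lift n la mu d' e' de out strip.
have := sumn_beta_lift lan mun lift_eq => /= sum_beta_eq.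
split=> //; first by rewrite -sum_eq; lia.
rewrite (@det_move_step r n _ (beta n.+1 la) (beta n.+1 mu) d' e')//.
- rewrite /strip_sgn hgt /=; congr (_ * _)%R.
  by rewrite -signr_odd -[in RHS]signr_odd oddD oddB// addbC.
- by move=> /=; lia.
(* The bead c_d is not a bead of nu: above row d, nu has the larger beads of la, and from row d on
   its beads are smaller than c_d. *)
move=> j /=; apply/eqP; case: (ltnP j d) => [jd|dj].
  have -> : beta n.+1 nu j = beta n.+1 la j.
    have h : nth 0 la j <= nth 0 nu j by apply: before_first_row; rewrite fd.
    have h' : nth 0 nu j <= nth 0 la j by rewrite [X in _ <= X]out//; left.
    by rewrite /beta; congr (_ + _)%N; lia.
  by have := @beta_decr n.+1 la j d pla jd (leq_ltn_trans de en); lia.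
have := is_part_nth pnu dj; have := numu d.
by rewrite /beta; have := ltn_ord j; lia.
Qed.

Lemma final_strip_ex n r nu la : 0 < r -> is_part nu -> is_part la ->
  size nu <= n.+1 -> size la <= n.+1 -> la != nu ->
  (\det (move_mx r n.+1 (beta n.+1 nu) (beta n.+1 la)) != 0)%R ->
  exists mu, final_strip r nu la mu.
Proof.
move=> r_gt0 pnu pla nun lan la_nu det0.
have sub_of mu : is_part mu ->
    (\det (move_mx r n.+1 (beta n.+1 nu) (beta n.+1 mu)) != 0)%R ->
    forall i, nth 0 nu i <= nth 0 mu i.
  move=> pmu det_mu i; case: (ltnP i n.+1) => [i_n|/(leq_trans nun)/(nth_default 0) -> //].
  rewrite leqNgt; apply: contra_neqN det_mu => lt_i.
  apply: (@det_move_eq0 _ _ _ _ i) => //; try by move=> k j; exact: beta_decr.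
  by rewrite /beta ltn_add2r.
have sub := sub_of _ pla det0.
have ex : exists i, nth 0 nu i < nth 0 la i.
  apply/not_existsP => none; move/eqP: la_nu; apply.
  by apply: is_part_inj => // i; have := none i; have := sub i; lia.
case: (ex_minnP ex) => d lt_d d_min.
have dn : d < n.+1 by apply: leq_trans lan; rewrite is_part_size//; lia.
have eq_lt i : i < d -> nth 0 la i = nth 0 nu i.
  move=> id; apply/eqP; rewrite eqn_leq sub andbT leqNgt.
  by apply/negP => /d_min; lia.
pose c := beta n.+1 la.
have cdb (j : 'I_n.+1) : c (Ordinal dn) != beta n.+1 nu j.
  rewrite /c; case: (ltnP j d) => [jd|dj].
    have -> : beta n.+1 nu j = beta n.+1 la j by rewrite /beta eq_lt.
    by have := @beta_decr n.+1 la j d pla jd dn => /=; lia.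
  by have := is_part_nth pnu dj; rewrite /beta /=; have := ltn_ord j; lia.
have [/= r_cd noc] := det_move_neq0 r_gt0 cdb det0.
(* The landing position, and below the rank [e] it receives: the last index whose bead in la is
   still above [x]. *)
pose x := (c d - r)%N.
have ex_e : exists i, (i < n.+1) && (x < c i).
  by exists d; rewrite dn /x /=; lia.
have bnd_e i : (i < n.+1) && (x < c i) -> i <= n.+1 by case/andP => /ltnW.
case: (ex_maxnP ex_e bnd_e) => e /andP[en xe] e_max.
have de : d <= e by apply: e_max; rewrite dn /x /=; lia.
have next i : e < i -> i < n.+1 -> c i < x.
  move=> ei i_n; rewrite ltn_neqAle (noc (Ordinal i_n)) /= leqNgt.
  by apply/negP => h; have := e_max i; rewrite i_n h => /(_ isT); lia.
have xn : n - e <= x.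
  case: (ltnP e n) => [e_n|]; last by lia.
  by have := next e.+1 (ltnSn e) e_n; rewrite /c /beta; lia.
have la_e : n - e + nth 0 la e > x by move: xe; rewrite /c /beta; lia.
have la_e1 : nth 0 la e.+1 + (n - e) <= x.
  case: (ltnP e n) => [e_n|en'].
    by have := next e.+1 (ltnSn e) e_n; rewrite /c /beta; lia.
  by rewrite nth_default; lia.
have la_gt0 i : i <= e -> 0 < nth 0 la i.
  by move=> ie; have := is_part_nth pla ie; lia.
(* Row lengths read off the moved beads: those of ranks d + 1, ..., e go up one rank and lose a box,
   and the bead [x] takes rank e, where the staircase contributes n - e. By [xn] this last
   subtraction is exact. *)
pose g i := if (i < d) || (e < i) then nth 0 la i else
  if i < e then (nth 0 la i.+1).-1 else (x - (n - e))%N.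
have g_out i : i < d \/ e < i -> g i = nth 0 la i.
  by rewrite /g => -[] ->; rewrite ?orbT.
have g_mid i : d <= i < e -> g i = (nth 0 la i.+1).-1.
  by case/andP => di ie; rewrite /g ltnNge di ltnNge (ltnW ie) ie.
have g_e : g e = (x - (n - e))%N by rewrite /g ltnNge de ltnn.
have g_lt_e : g e < nth 0 la e by rewrite g_e; lia.
have g_le i : g i <= nth 0 la i.
  have := is_part_nth pla (leqnSn i).
  have [die|die] := boolP (d <= i < e); first by rewrite g_mid//; lia.
  have [->|ie] := eqVneq i e; first by lia.
  by rewrite g_out//; lia.
have g_sorted : sorted geq (mkseq g n.+1).
  apply/(sortedP 0) => i; rewrite size_mkseq => i_n.
  rewrite !nth_mkseq//; last by lia.
  have gi := g_le i.+1; have := is_part_nth pla (leqnSn i).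
  have [die|die] := boolP (d <= i < e).
    rewrite (g_mid i)//; have [ie|ie] := eqVneq i.+1 e.
      by move: g_lt_e; rewrite -ie /=; lia.
    rewrite g_mid /=; last by lia.
    by have := is_part_nth pla (leqnSn i.+1); lia.
  have [->|ie] := eqVneq i e; last by rewrite (g_out i) /=; lia.
  by move=> _ /=; rewrite g_out; [rewrite g_e; lia|right].
pose mu := strip_zeros (mkseq g n.+1).
have pmu : is_part mu := is_part_strip_zeros g_sorted.
have mu_g i : nth 0 mu i = g i.
  rewrite nth_strip_zeros//; case: (ltnP i n.+1) => i_n; first by rewrite nth_mkseq.
  by rewrite nth_default ?size_mkseq// g_out ?nth_default//; [lia|right; lia].
have out i : i < d \/ e < i -> nth 0 la i = nth 0 mu i by rewrite mu_g => /g_out.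
have strip i : d <= i < e -> nth 0 la i.+1 = (nth 0 mu i).+1.
  by move=> die; rewrite mu_g g_mid// prednK// la_gt0//; lia.
have sub_mu : subdiagram mu la by apply/subdiagramP => i; rewrite mu_g.
have mun : size mu <= n.+1 by apply: leq_trans lan; apply: sub_size.
have lift_eq := @beta_lift n la mu (Ordinal dn) (Ordinal en) de out strip.
have beta_e : c d = (beta n.+1 mu e + r)%N.
  by rewrite /beta mu_g g_e subSS subnK// /x subnK.
have size_eq : (sumn la - sumn mu)%N = r.
  by have := sumn_beta_lift lan mun lift_eq; rewrite /= -/(c d); lia.
(* This yields that nu is contained in mu, through [sub_of], with no comparison of row lengths. *)
have det_mu : (\det (move_mx r n.+1 (beta n.+1 nu) (beta n.+1 mu)) != 0)%R.
  apply: contraNneq det0 => det_mu.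
  rewrite (@det_move_step r n _ _ (beta n.+1 mu) (Ordinal dn) (Ordinal en))//.
  by rewrite det_mu mulr0.
have mu_d : nth 0 mu d < nth 0 la d.
  rewrite mu_g; move: de; rewrite leq_eqVlt => /predU1P[-> //|de'].
  rewrite g_mid ?leqnn//; have := is_part_nth pla (leqnSn d).
  by have := la_gt0 d.+1 de'; lia.
exists mu; apply/and3P; split.
- by rewrite -size_eq; apply: (@border_strip_intro _ _ d e) => //; rewrite mu_g.
- exact/subdiagramP/sub_of.
by rewrite (first_row_eq lt_d) => // i /eq_lt ->.
Qed.

(** Each final strip contributes its sign as a factor ([final_stripP]). As the right-hand side does
    not mention [s], all decompositions have the same sign, including the one picked by
    [xchoose]. *)
Lemma det_move_decomposition n r nu la s : 0 < r -> is_part nu -> is_part la ->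
  size la <= n.+1 -> decomposition r la nu s ->
  decomposition_sgn la s =
  (\det (move_mx r n.+1 (beta n.+1 nu) (beta n.+1 la)))%R.
Proof.
move=> r_gt0 pnu; elim: s la => [|mu s IH] la pla lan; rewrite /decomposition /=.
  move=> /eqP ->; rewrite /decomposition_sgn big_nil det_move_refl//.
  by move=> i j; exact: beta_decr.
rewrite -andbA => /andP[fs dec].
have [pmu mun _ ->] := final_stripP r_gt0 pnu pla lan fs.
by rewrite /decomposition_sgn /= big_cons -(IH _ pmu mun dec).
Qed.

(** As long as the determinant is nonzero, [final_strip_ex] provides another strip to remove; by
    induction on the size of la, the absence of a decomposition forces the determinant to vanish. *)
Lemma sgn_r_det n r nu la : 0 < r -> is_part nu -> is_part la ->
  size nu <= n.+1 -> size la <= n.+1 ->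
  sgn_r r la nu = (\det (move_mx r n.+1 (beta n.+1 nu) (beta n.+1 la)))%R.
Proof.
move=> r_gt0 pnu pla nun lan; rewrite /sgn_r; case: pselect => [ex|no].
  by apply: det_move_decomposition => //; exact: xchooseP.
apply/esym/eqP/negPn/negP => det0; apply: no.
have [k] := ubnP (sumn la); elim: k la pla lan det0 => // k IH la pla lan det0 lak.
have [->|la_nu] := eqVneq la nu; first by exists [::]; rewrite /decomposition /= eqxx.
have [mu fs] := final_strip_ex r_gt0 pnu pla nun lan la_nu det0.
have [pmu mun lt_mu det_mu] := final_stripP r_gt0 pnu pla lan fs.
have [||||s dec] := IH mu => //; last by exists (mu :: s); rewrite /decomposition /= fs.
  by apply: contraNneq det0 => det_mu0; rewrite det_mu det_mu0 mulr0.
exact: leq_trans lt_mu lak.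
Qed.

(** * Alternants *)

Local Open Scope ring_scope.

Section Alternants.
Variables (R : comNzRingType) (x : nat -> R).

Definition alternant (n : nat) (b : 'I_n -> nat) : R :=
  \det (\matrix_(i < n, j < n) x i ^+ b j).

(** The alternant a_(la + delta), with delta = (n - 1, ..., 1, 0); for [[::]] it is the Vandermonde
    determinant. *)
Definition part_alternant (n : nat) (la : seq nat) : R :=
  alternant (fun i : 'I_n => beta n la i).

Lemma eq_alternant n (b c : 'I_n -> nat) : b =1 c -> alternant b = alternant c.
Proof. by move=> bc; congr (\det _); apply/matrixP => i j; rewrite !mxE bc. Qed.

Lemma sum_ord_interval (p q k : nat) (F : nat -> R) : (p <= q < k)%N ->
  \sum_(m < k | (p <= m <= q)%N) F m = \sum_(i < (q - p).+1) F (i + p)%N.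
Proof.
case/andP => pq qk; rewrite -subSn// -(big_mkord xpredT (fun i => F (i + p)%N)).
rewrite -(big_addn 0 q.+1 p xpredT F) (big_nat_widenl _ 0)// (big_nat_widen _ _ _ _ _ qk).
by rewrite big_mkord; apply: eq_bigl => i; rewrite ltnS.
Qed.

Lemma sum_interval_geom (a b : R) (p q k : nat) : (p <= q < k)%N ->
  (a - b) * \sum_(m < k | (p <= m <= q)%N) a ^+ m * b ^+ (q - m) =
  a ^+ q.+1 - a ^+ p * b ^+ (q.+1 - p).
Proof.
move=> pqk; rewrite (sum_ord_interval (fun m => a ^+ m * b ^+ (q - m)) pqk).
case/andP: pqk => pq _.
transitivity (a ^+ p * (a ^+ (q - p).+1 - b ^+ (q - p).+1)); last first.
  by rewrite mulrBr -exprD subSn//; congr (_ ^+ _ - _); lia.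
rewrite -[X in _ = _ * X]opprB subrXX -mulNr opprB mulrCA; congr (_ * _).
rewrite big_distrr; apply: eq_bigr => i _ /=.
rewrite addnC exprD -mulrA [X in _ = _ * X]mulrC; congr (_ * (_ * _ ^+ _)).
by have := ltn_ord i; lia.
Qed.

Definition fseq n k (f : {ffun 'I_n -> 'I_k}) : seq nat :=
  [seq val (f i) | i <- enum 'I_n].

Lemma size_fseq n k (f : {ffun 'I_n -> 'I_k}) : size (fseq f) = n.
Proof. by rewrite size_map size_enum_ord. Qed.

Lemma nth_fseq n k (f : {ffun 'I_n -> 'I_k}) (i : 'I_n) :
  nth 0%N (fseq f) i = f i.
Proof. by rewrite (nth_map i) ?size_enum_ord// nth_ord_enum. Qed.

Definition interlacing n k (la : seq nat) (f : {ffun 'I_n -> 'I_k}) : bool :=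
  [forall i : 'I_n, (nth 0 la i.+1 <= f i <= nth 0 la i)%N].

(** Subtracting from each column a power of x_n times the next one clears the last row up to its
    last entry. Each entry (i, j) of the remaining minor is x_i - x_n times a geometric sum over the
    interval from la_(j+1) to la_j, and multilinearity gives the sum over interlacing sequences.
    These may end in zeros, hence [sorted geq] in place of [is_part]. *)
Lemma alternant_branch n k la : sorted geq la -> (nth 0 la 0 < k)%N ->
  part_alternant n.+1 la = (\prod_(i < n) (x i - x n)) *
    \sum_(f : {ffun 'I_n -> 'I_k} | interlacing la f)
      x n ^+ (nth 0 la n + \sum_(i < n) (nth 0 la i - f i)) *
      part_alternant n (fseq f).
Proof.
move=> sla lak; set c := beta n.+1 la.
have la_le i j : (i <= j)%N -> (nth 0 la j <= nth 0 la i)%N.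
  by move=> ij; rewrite -!(nth_strip_zeros _ sla) is_part_nth// is_part_strip_zeros.
have c_le j : (j < n)%N -> (c j.+1 <= c j)%N.
  by move=> jn; have := la_le _ _ (leqnSn j); rewrite /c /beta; lia.
pose A := \matrix_(i < n.+1, j < n.+1) x i ^+ c j.
pose U := \matrix_(i < n.+1, j < n.+1)
  ((i == j)%:R - (i == j.+1 :> nat)%:R * x n ^+ (c j - c j.+1)).
have detU : \det U = 1.
  rewrite det_trig; last first.
    apply/is_trig_mxP => i j ij; rewrite !mxE.
    by rewrite -val_eqE /= ltn_eqF// ltn_eqF ?mul0r ?subrr// ltnS ltnW.
  by apply: big1 => i _; rewrite !mxE eqxx ltn_eqF// mul0r subr0.
have AU i (j : 'I_n.+1) : (A *m U) i j = x i ^+ c j -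
    (j < n)%N%:R * x i ^+ c j.+1 * x n ^+ (c j - c j.+1).
  rewrite mxE; under eq_bigr do rewrite !mxE mulrBr.
  rewrite sumrB; congr (_ - _).
    by rewrite (bigD1 j)//= eqxx mulr1 big1 ?addr0// => l /negPf ->; rewrite mulr0.
  case: (ltnP j n) => jn; last first.
    rewrite big1 ?mul0r// => l _; rewrite ltn_eqF ?mul0r ?mulr0//.
    exact: leq_trans (ltn_ord l) _.
  rewrite mul1r (bigD1 (Ordinal (jn : j.+1 < n.+1)%N))//= eqxx mul1r big1 ?addr0//.
  by move=> l; rewrite -val_eqE /= => /negPf ->; rewrite mul0r mulr0.
have -> : part_alternant n.+1 la = \det (A *m U) by rewrite det_mulmx detU mulr1.
rewrite (expand_det_row _ ord_max) (bigD1 ord_max)//= [X in _ + X]big1 => [|j jn]; last first.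
  have jn' : (j < n)%N by rewrite ltn_neqAle -ltnS ltn_ord andbT.
  by rewrite AU jn' mul1r -exprD /= subnKC ?c_le// subrr mul0r.
rewrite addr0 AU /= ltnn !mul0r subr0 /cofactor exprD -expr2 sqrr_sign mul1r.
have -> : c n = nth 0%N la n by rewrite /c /beta subnn addn0.
(* The exponent of x_i is the bead, among n, of a row j of length m; the exponent of x_n counts the
   boxes missing from that row. *)
pose G (i : nat) (j : 'I_n) (m : 'I_k) : R :=
  x i ^+ (m + (n - j.+1)) * x n ^+ (nth 0 la j - m).
pose Q (j : 'I_n) := [pred m : 'I_k | (nth 0 la j.+1 <= m <= nth 0 la j)%N].
pose M := \matrix_(i < n, j < n) \sum_(m | Q j m) G i j m.
have -> : row' ord_max (col' ord_max (A *m U)) = diag_mx (\row_i (x i - x n)) *m M.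
  apply/matrixP => i j; rewrite mul_diag_mx mxE mxE AU !mxE !lift_max ltn_ord mul1r.
  have jn := ltn_ord j.
  have pqk : (nth 0 la j.+1 <= nth 0 la j < k)%N.
    by rewrite la_le// (leq_ltn_trans _ lak)// la_le.
  have -> : c j = ((n - j.+1) + (nth 0 la j).+1)%N by rewrite /c /beta; lia.
  have -> : c j.+1 = ((n - j.+1) + nth 0 la j.+1)%N by rewrite /c /beta; lia.
  have -> : ((n - j.+1) + (nth 0 la j).+1 - ((n - j.+1) + nth 0 la j.+1) =
             (nth 0 la j).+1 - nth 0 la j.+1)%N by lia.
  rewrite !exprD -mulrA -mulrBr -(sum_interval_geom _ _ pqk) mulrCA; congr (_ * _).
  by rewrite big_distrr; apply: eq_bigr => m _; rewrite /G /= addnC exprD mulrA.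
rewrite det_mulmx det_diag mulrCA; congr (_ * _).
  by apply: eq_bigr => i _; rewrite mxE.
have -> : \det M = \sum_(s : 'S_n) \sum_(f in family Q)
    (-1) ^+ s * \prod_(j < n) G (s j) j (f j).
  rewrite -det_tr; apply: eq_bigr => s _.
  rewrite -big_distrr -(bigA_distr_big_dep Q (fun j => G (s j) j)); congr (_ * _).
  by apply: eq_bigr => j _; rewrite !mxE.
rewrite exchange_big /= big_distrr; apply: eq_big => [f|f _].
  by apply/familyP/forallP => h i; have := h i; rewrite inE.
rewrite /part_alternant /alternant -det_tr /determinant big_distrr big_distrr.
apply: eq_bigr => s _ /=; rewrite mulrCA [RHS]mulrCA; congr (_ * _).
rewrite exprD -mulrA; congr (_ * _); rewrite expr_sum mulrC -big_split.
apply: eq_bigr => i _; rewrite !mxE /beta nth_fseq /=.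
by [].
Qed.

Lemma alternant_eq0 n (b : 'I_n -> nat) i j : i != j -> b i = b j -> alternant b = 0.
Proof.
move=> ij bij; rewrite /alternant -det_tr; apply: (determinant_alternate ij) => k.
by rewrite !mxE bij.
Qed.

Lemma alternant_perm n (b : 'I_n -> nat) (s : 'S_n) :
  alternant (fun i => b (s i)) = (-1) ^+ s * alternant b.
Proof.
rewrite mulrC -odd_permV -det_perm -det_mulmx -col_permE.
by congr (\det _); apply/matrixP => i j; rewrite !mxE.
Qed.

Definition weight n (f : 'I_n -> nat) : nat := (\sum_i f i)%N.

(** p_r o h_m in n variables; exponents of total m are at most m, so ['I_m.+1] loses none. *)
Definition power_complete (r m n : nat) : R :=
  \sum_(f : {ffun 'I_n -> 'I_m.+1} | weight (fun i => f i) == m) \prod_(i < n) x i ^+ (r * f i).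

Lemma weight_perm n (f : 'I_n -> nat) (s : 'S_n) : weight (f \o s) = weight f.
Proof. by rewrite /weight [RHS](reindex_inj (@perm_inj _ s)). Qed.

(** The second factor is symmetric, so within the term of a permutation s its exponents may be
    permuted by s and merged with those of the alternant. *)
Lemma alternant_power_complete r m n (b : 'I_n -> nat) :
  alternant b * power_complete r m n =
  \sum_(f : {ffun 'I_n -> 'I_m.+1} | weight (fun i => f i) == m)
     alternant (fun i => (b i + r * f i)%N).
Proof.
rewrite /alternant exchange_big big_distrl /=; apply: eq_bigr => s _.
rewrite -mulrA -big_distrr; congr (_ * _); rewrite big_distrr /=.
pose h (f : {ffun 'I_n -> 'I_m.+1}) := [ffun i => f (s i)].
have h_inj : injective h.
  move=> f g /ffunP fg; apply/ffunP => i.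
  by have := fg (s^-1 i)%g; rewrite !ffunE permKV.
rewrite (reindex_inj h_inj); apply: eq_big => [f|f _].
  rewrite -[in RHS](weight_perm _ s); congr (_ == _).
  by apply: eq_bigr => i _; rewrite ffunE.
rewrite -big_split; apply: eq_bigr => i _.
by rewrite !mxE /h /= ffunE exprD.
Qed.

(** The sum now runs over the resulting exponents instead of the increments. The condition becomes a
    product of one indicator per index, ready to be a term of a determinant. *)
Lemma alternant_power_complete_reach r m n k (b : 'I_n -> nat) : (0 < r)%N ->
  (weight b + r * m < k)%N ->
  alternant b * power_complete r m n =
  \sum_(f : {ffun 'I_n -> 'I_k} | weight (fun i => f i) == (weight b + r * m)%N)
     (\prod_i ((b i <= f i)%N && (r %| f i - b i)%N)%:R) * alternant (fun i => f i).
Proof.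
move=> r_gt0 lt_k; rewrite alternant_power_complete.
rewrite (bigID (fun f : {ffun 'I_n -> 'I_k} =>
  [forall i, (b i <= f i)%N && (r %| f i - b i)%N])) /=.
rewrite [X in _ = _ + X]big1 ?addr0 => [|f /andP[_]]; last first.
  rewrite negb_forall => /existsP[i /negPf bi].
  by rewrite (bigD1 i)//= bi !mul0r.
have k_gt0 : (0 < k)%N by lia.
case: k => // k in lt_k k_gt0 *.
(* [up] and [down] are inverse to each other on the sequences of the right weight; the weight bounds
   every value, so [inord] is faithful there. *)
pose up (f : {ffun 'I_n -> 'I_m.+1}) : {ffun 'I_n -> 'I_k.+1} :=
  [ffun i => inord (b i + r * f i)].
pose down (f : {ffun 'I_n -> 'I_k.+1}) : {ffun 'I_n -> 'I_m.+1} :=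
  [ffun i => inord ((f i - b i) %/ r)].
have weight_le p (f : 'I_n -> nat) i : weight f = p -> (f i <= p)%N.
  by move=> <-; rewrite /weight (bigD1 i)//= leq_addr.
have wD (f : 'I_n -> nat) : weight (fun i => (b i + r * f i)%N) = (weight b + r * weight f)%N.
  by rewrite /weight big_split -big_distrr.
have upE (f : {ffun 'I_n -> 'I_m.+1}) i :
    weight (fun i => f i) = m -> up f i = (b i + r * f i)%N :> nat.
  move=> wf; rewrite ffunE inordK//; apply: leq_ltn_trans lt_k.
  by rewrite -[X in (_ <= _ + _ * X)%N]wf -wD; apply: (weight_le _ (fun i => (b i + r * f i)%N)).
rewrite [RHS](reindex_onto up down); last first.
  move=> f /andP[/eqP wf /forallP bf]; apply/ffunP => i; apply: val_inj.
  have fE j : f j = (b j + r * ((f j - b j) %/ r))%N :> nat.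
    by have /andP[bj rj] := bf j; rewrite mulnC divnK// subnKC.
  have wd : weight (fun i => (f i - b i) %/ r)%N = m.
    apply/eqP; rewrite -(eqn_pmul2l r_gt0) -(eqn_add2l (weight b)) -wD -wf.
    by apply/eqP; apply: eq_bigr => j _; rewrite -fE.
  have dE j : down f j = ((f j - b j) %/ r)%N :> nat.
    by rewrite ffunE inordK// ltnS; apply: (weight_le _ (fun i => (f i - b i) %/ r)%N).
  rewrite /= upE ?dE -?fE//.
  by rewrite -[RHS]wd; apply: eq_bigr => j _; rewrite dE.
apply: eq_big => [f|f /eqP wf]; last first.
  rewrite [X in _ = X * _]big1 ?mul1r => [|i _].
    by apply: eq_alternant => i; rewrite upE.
  by rewrite upE// leq_addr addKn dvdn_mulr.
apply/eqP/idP => [wf|].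
  have E i := upE f i wf.
  have -> : weight (fun i => up f i) = (weight b + r * m)%N.
    by rewrite -[in RHS]wf -wD; apply: eq_bigr => i _.
  rewrite eqxx /=; apply/andP; split.
    by apply/forallP => i; rewrite E leq_addr addKn dvdn_mulr.
  apply/eqP/ffunP => i; apply: val_inj.
  by rewrite ffunE E addKn mulKn//= inordK.
case/andP=> /andP[/eqP wu /forallP bu] /eqP/ffunP dK.
have uE i : up f i = (b i + r * ((up f i - b i) %/ r))%N :> nat.
  by have /andP[bi ri] := bu i; rewrite mulnC divnK// subnKC.
have wg : weight (fun i => (up f i - b i) %/ r)%N = m.
  apply/eqP; rewrite -(eqn_pmul2l r_gt0) -(eqn_add2l (weight b)) -wD -wu.
  by apply/eqP; apply: eq_bigr => j _; rewrite -uE.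
rewrite -[RHS]wg; apply: eq_bigr => i _; rewrite -dK ffunE inordK// ltnS.
exact: (weight_le _ (fun i => (up f i - b i) %/ r)%N).
Qed.
End Alternants.

(** * Collecting alternants over decreasing exponent sequences *)

Definition decreasing n k (c : {ffun 'I_n -> 'I_k}) : bool :=
  [forall i : 'I_n, forall j : 'I_n, (i < j)%N ==> (c j < c i)%N].

Lemma decreasingP n k (c : {ffun 'I_n -> 'I_k}) :
  reflect (forall i j : 'I_n, (i < j)%N -> (c j < c i)%N) (decreasing c).
Proof.
apply: (iffP forallP) => [h i j|h i]; last by apply/forallP => j; apply/implyP/h.
by move: i (h i) => i /forallP/(_ j)/implyP.
Qed.

Lemma decreasing_inj n k (c : {ffun 'I_n -> 'I_k}) : decreasing c -> injective c.
Proof.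
move=> /decreasingP dc i j cij; apply: val_inj; apply/eqP.
by case: ltngtP => // /dc; rewrite cij ltnn.
Qed.

Lemma decreasing_sorted n k (c : {ffun 'I_n -> 'I_k}) :
  decreasing c -> sorted gtn (fseq c).
Proof.
move=> /decreasingP dc; apply/(sortedP 0%N) => i; rewrite size_fseq => lt_i.
by rewrite (nth_fseq c (Ordinal lt_i)) (nth_fseq c (Ordinal (ltnW lt_i))); apply: dc.
Qed.

Lemma decreasing_perm_eq n k (c d : {ffun 'I_n -> 'I_k}) (s t : 'S_n) :
  decreasing c -> decreasing d -> (forall i, c (s i) = d (t i)) -> c = d.
Proof.
move=> dc dd cd.
have sub (c1 c2 : {ffun 'I_n -> 'I_k}) (s1 s2 : 'S_n) : (forall i, c1 (s1 i) = c2 (s2 i)) ->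
    {subset fseq c1 <= fseq c2}.
  move=> c12 _ /mapP[i _ ->]; apply/mapP; exists (s2 (s1^-1 i)%g); rewrite ?mem_enum//.
  by rewrite -c12 permKV.
have eq_s := irr_sorted_eq (fun a b e h h' => ltn_trans h' h) ltnn
  (decreasing_sorted dc) (decreasing_sorted dd).
 apply/ffunP => i; apply: val_inj.
rewrite /= -!nth_fseq eq_s// => a.
by apply/idP/idP; [exact: (sub _ _ s t)|apply: (sub _ _ t s)].
Qed.

Lemma injective_decreasing n k (f : {ffun 'I_n -> 'I_k}) : injective f ->
  exists (c : {ffun 'I_n -> 'I_k}) (s : 'S_n), decreasing c /\ forall i, f i = c (s i).
Proof.
move=> f_inj; pose r := [rel a b : 'I_k | (b <= a)%N].
pose t := [tuple of sort r [tuple f i | i < n]].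
have pt : perm_eq [tuple f i | i < n] t by rewrite perm_sym perm_sort.
have [s fs] := tuple_permP pt.
exists [ffun i => tnth t i], s; split=> [|i]; last first.
  rewrite ffunE -(tnth_mktuple f i) (val_inj fs : [tuple f i | i < n] = _).
  by rewrite tnth_mktuple.
have ut : uniq t by rewrite -(perm_uniq pt) map_inj_uniq ?enum_uniq.
have st : sorted r t.
  by apply: sort_sorted => a b /=; exact: leq_total.
have rt : transitive r by move=> a b d /= h h'; exact: leq_trans h' h.
apply/decreasingP => i j ij; rewrite !ffunE ltn_neqAle; apply/andP; split.
  rewrite (tnth_nth (tnth t i)) [tnth t i in X in _ != X](tnth_nth (tnth t i)).
  by rewrite val_eqE nth_uniq ?size_tuple//; lia.
rewrite (tnth_nth (tnth t i)) [tnth t i in X in (_ <= X)%N](tnth_nth (tnth t i)).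
have := sorted_leq_nth rt (fun a => leqnn a) (tnth t i) st.
by apply; rewrite ?inE ?size_tuple// ltnW.
Qed.

(** A repeated exponent gives a zero alternant. Any other sequence is, in a unique way, a decreasing
    one composed with a permutation, whose sign comes out of the alternant. *)
Lemma alternant_sum_decreasing (R : comNzRingType) (x : nat -> R) n k T
    (W : 'I_n -> nat -> R) :
  \sum_(f : {ffun 'I_n -> 'I_k} | weight (fun i => f i) == T)
    (\prod_i W i (f i)) * alternant x (fun i => f i) =
  \sum_(c : {ffun 'I_n -> 'I_k} | decreasing c && (weight (fun i => c i) == T))
    (\sum_(s : 'S_n) (-1) ^+ s * \prod_i W i (c (s i))) * alternant x (fun i => c i).
Proof.
pose F (f : {ffun 'I_n -> 'I_k}) := (\prod_i W i (f i)) * alternant x (fun i => f i).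
pose h (p : {ffun 'I_n -> 'I_k} * 'S_n) := [ffun i => p.1 (p.2 i)].
pose D := [set p : {ffun 'I_n -> 'I_k} * 'S_n |
  decreasing p.1 && (weight (fun i => p.1 i) == T)].
have h_inj : {in D &, injective h}.
  move=> [c s] [d t]; rewrite !inE /= => /andP[dc _] /andP[dd _] /ffunP cd.
  have cdE i : c (s i) = d (t i) by have := cd i; rewrite !ffunE.
  have E := decreasing_perm_eq dc dd cdE; subst d; congr (_, _).
  by apply/permP => i; apply: (decreasing_inj dc).
transitivity (\sum_(f in h @: D) F f); last first.
  rewrite big_imset//=; under [RHS]eq_bigr => c _ do rewrite big_distrl.
  rewrite pair_big_dep /=; apply: eq_big => [[c s]|[c s] _]; first by rewrite inE andbT.
  rewrite /F; under eq_bigr do rewrite ffunE.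
  rewrite (eq_alternant _ (c := fun i => c (s i))) => [|i]; last by rewrite ffunE.
  by rewrite (alternant_perm x (fun i => c i)) mulrCA mulrA.
rewrite (bigID (mem (h @: D))) /= [X in _ + X]big1 ?addr0 => [|f /andP[/eqP wf fD]].
  apply: eq_bigl => f; rewrite andb_idl// => /imsetP[[c s]]; rewrite inE.
  case/andP=> _ /eqP <- ->; rewrite -(weight_perm (fun i => c i) s); apply/eqP.
  by apply: eq_bigr => i _; rewrite ffunE.
have [/injectiveP f_inj|/injectivePn[i [j ij fij]]] := boolP (injectiveb f).
  have [c [s [dc fE]]] := injective_decreasing f_inj.
  case/negP: fD; apply/imsetP; exists (c, s); last by apply/ffunP => i; rewrite ffunE fE.
  rewrite inE dc /= -wf -(weight_perm (fun i => c i) s); apply/eqP.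
  by apply: eq_bigr => i _; rewrite fE.
by rewrite (@alternant_eq0 _ _ _ _ i j)// ?mulr0// fij.
Qed.

(** The signed sum over permutations in [alternant_sum_decreasing] is the Leibniz formula for the
    transpose of [move_mx]. Since [move_mx] takes beads indexed by [nat], [b'] extends [b]. *)
Lemma alternant_pieri (R : comNzRingType) (x : nat -> R) r m n k (b : 'I_n -> nat)
    (b' : nat -> nat) : (0 < r)%N -> (weight b + r * m < k)%N -> b =1 b' ->
  alternant x b * power_complete x r m n =
  \sum_(c : {ffun 'I_n -> 'I_k} | decreasing c &&
      (weight (fun i => c i) == (weight b + r * m)%N))
    alternant x (fun i => c i) *~ \det (move_mx r n b' (nth 0%N (fseq c))).
Proof.
move=> r_gt0 lt_k bb'; rewrite (alternant_power_complete_reach _ r_gt0 lt_k).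
rewrite (alternant_sum_decreasing x k _ (fun i a => ((b i <= a)%N && (r %| a - b i)%N)%:R)).
apply: eq_bigr => c _; rewrite -mulrzl; congr (_ * _).
rewrite -det_tr /determinant rmorph_sum; apply: eq_bigr => s _.
rewrite rmorphM rmorph_sign rmorph_prod; congr (_ * _); apply: eq_bigr => i _.
by rewrite !mxE /= rmorph_nat nth_fseq bb'.
Qed.

(** * Tableaux with bounded entries *)

Section Tableaux.
(* [M] is a fixed bound: tableaux of a given shape with entries below [n] live *)
(* in one type for all [n <= M.+1].                                            *)
Variable M : nat.

Definition entry la (T : {ffun seq_sub (diagram la) -> 'I_M.+1}) (b : box) : nat :=
  if insub b is Some u then T u else 0.

Definition fill la (e : box -> nat) : {ffun seq_sub (diagram la) -> 'I_M.+1} :=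
  [ffun u => inord (e (ssval u))].

Definition bounded_tableau n la (T : {ffun seq_sub (diagram la) -> 'I_M.+1}) : bool :=
  semistandard [ffun b => T b : nat] && [forall b, (T b < n)%N].

(** Stated for functions on all boxes, so that tableaux of different shapes can be compared without
    passing between the types [seq_sub (diagram la)]. *)
Definition semistandard_fun n la (e : box -> nat) : Prop :=
  [/\ forall i j j', (j <= j')%N -> (j' < nth 0 la i)%N -> (e (i, j) <= e (i, j'))%N,
      forall i i' j, (i < i')%N -> (j < nth 0 la i)%N -> (j < nth 0 la i')%N ->
        (e (i, j) < e (i', j))%N
    & forall i j, (j < nth 0 la i)%N -> (e (i, j) < n)%N].

Lemma entryE la (T : {ffun seq_sub (diagram la) -> 'I_M.+1}) u :
  entry T (ssval u) = T u.
Proof. by rewrite /entry; have -> : insub (ssval u) = Some u by exact: valK. Qed.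

Lemma entry_le la (T : {ffun seq_sub (diagram la) -> 'I_M.+1}) b :
  (entry T b <= M)%N.
Proof. by rewrite /entry; case: insubP => // u _ _; rewrite -ltnS. Qed.

Lemma fillK la (T : {ffun seq_sub (diagram la) -> 'I_M.+1}) : fill la (entry T) = T.
Proof. by apply/ffunP => u; apply: val_inj; rewrite ffunE entryE inord_val. Qed.

Lemma entry_fill la e b :
  b \in diagram la -> (e b <= M)%N -> entry (fill la e) b = e b.
Proof.
by move=> bla eb; rewrite -[b]/(ssval (SeqSub bla)) entryE ffunE inordK.
Qed.

Lemma bounded_tableauP n la (T : {ffun seq_sub (diagram la) -> 'I_M.+1}) :
  reflect (semistandard_fun n la (entry T)) (bounded_tableau n T).
Proof.
have box_in i j : (j < nth 0 la i)%N -> (i, j) \in diagram la by rewrite mem_diagram.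
apply: (iffP andP) => [[/forallP sst /forallP bnd]|[row col bnd]].
  split=> [i j j' jj' j'la|i i' j ii' jla jla'|i j jla].
  - have /forallP/(_ (SeqSub (box_in _ _ j'la)))/andP[+ _] :=
      sst (SeqSub (box_in _ _ (leq_ltn_trans jj' j'la))).
    by rewrite /= eqxx jj' !ffunE -!entryE.
  - have /forallP/(_ (SeqSub (box_in _ _ jla')))/andP[_ +] :=
      sst (SeqSub (box_in _ _ jla)).
    by rewrite /= eqxx ii' !ffunE -!entryE.
  by have := bnd (SeqSub (box_in _ _ jla)); rewrite -entryE.
split; apply/forallP => -[[i j] ij]; last first.
  by rewrite -entryE /=; apply: bnd; rewrite -mem_diagram.
apply/forallP => -[[i' j'] ij']; rewrite !ffunE -!entryE /=.
move: (ij) (ij') => ijD ij'D; rewrite !mem_diagram in ijD ij'D.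
apply/andP; split; apply/implyP => /andP[/eqP E le_b]; subst.
  exact: row.
exact: col.
Qed.

Lemma big_seq_sub (R : Type) (idx : R) (op : Monoid.com_law idx) (I : choiceType)
    (s : seq I) (F : I -> R) : uniq s ->
  \big[op/idx]_(u : seq_sub s) F (ssval u) = \big[op/idx]_(i <- s) F i.
Proof.
move=> us; rewrite -(big_map (@ssval _ s) xpredT F); apply: perm_big.
apply: uniq_perm => // [|i]; first by rewrite map_inj_uniq ?index_enum_uniq//; exact: val_inj.
apply/mapP/idP => [[u _ ->]|si]; first exact: ssvalP.
by exists (SeqSub si); rewrite ?mem_index_enum.
Qed.

Variables (R : comNzRingType) (x : nat -> R).

Definition tableau_sum (n : nat) (la : seq nat) : R :=
  \sum_(T : {ffun seq_sub (diagram la) -> 'I_M.+1} | bounded_tableau n T)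
    \prod_b x (T b).

Lemma prod_entry la n (T : {ffun seq_sub (diagram la) -> 'I_M.+1}) :
  (size la <= n)%N ->
  \prod_b x (T b) = \prod_(i < n) \prod_(0 <= j < nth 0%N la i) x (entry T (val i, j)).
Proof.
move=> lan; rewrite -(big_diagram _ (fun b => x (entry T b)) lan).
rewrite -[RHS]big_seq_sub ?diagram_uniq//; apply: eq_bigr => u _.
by rewrite entryE.
Qed.

(** A predicate inherited by smaller numbers holds on an initial segment. It will be applied to the
    boxes of a row with entry below a bound. *)
Lemma count_iota_initial (p : pred nat) n :
  (forall i j, (i <= j)%N -> (j < n)%N -> p j -> p i) ->
  forall j, (j < n)%N -> p j = (j < count p (iota 0 n))%N.
Proof.
elim: n => // n IH mono j; have -> : count p (iota 0 n.+1) = (count p (iota 0 n) + p n)%N.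
  by rewrite -addn1 iotaD count_cat /= add0n addn0.
rewrite ltnS => jn.
have mono' i l : (i <= l)%N -> (l < n)%N -> p l -> p i.
  by move=> il ln; apply: mono => //; exact: ltnW.
have [pn|npn] := boolP (p n).
  have -> : count p (iota 0 n) = n.
    rewrite -[RHS](size_iota 0 n); apply/eqP; rewrite -all_count.
    by apply/allP => l; rewrite mem_iota add0n => ln; apply: mono pn => //; exact: ltnW.
  by rewrite addn1 ltnS jn; apply: mono pn.
rewrite addn0; move: jn; rewrite leq_eqVlt => /predU1P[->|jn]; last exact: IH.
rewrite (negPf npn); apply/esym/negbTE; rewrite -leqNgt.
by rewrite -[X in (_ <= X)%N](size_iota 0) count_size.
Qed.

(** Deleting the boxes with entry n leaves a tableau whose row lengths interlace with la, because a
    column contains n at most once; conversely, n can be written in the boxes of la outside any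
    interlacing shape. This is the recursion of [alternant_branch] without the product. *)
Lemma tableau_sum_branch n k la : (n <= M)%N -> sorted geq la ->
  (size la <= n.+1)%N -> (nth 0 la 0 < k)%N ->
  tableau_sum n.+1 la = \sum_(f : {ffun 'I_n -> 'I_k} | interlacing la f)
    x n ^+ (nth 0 la n + \sum_(i < n) (nth 0 la i - f i)) * tableau_sum n (fseq f).
Proof.
move=> nM sla lan; case: k => // k lak.
have la_le i j : (i <= j)%N -> (nth 0 la j <= nth 0 la i)%N.
  by move=> ij; rewrite -!(nth_strip_zeros _ sla) is_part_nth// is_part_strip_zeros.
have la_row i j : (j < nth 0 la i)%N -> (i <= n)%N.
  by move=> h; rewrite -ltnS (leq_trans _ lan)// ltnNge; apply: contraTN h => /(nth_default 0%N) ->.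
pose sh (T : {ffun seq_sub (diagram la) -> 'I_M.+1}) : {ffun 'I_n -> 'I_k.+1} :=
  [ffun i : 'I_n => inord (count (fun j => entry T (val i, j) < n)%N (iota 0 (nth 0 la i)))].
have shE T (i : 'I_n) :
    sh T i = count (fun j => entry T (val i, j) < n)%N (iota 0 (nth 0 la i)) :> nat.
  rewrite ffunE inordK//; apply: leq_ltn_trans (count_size _ _) _.
  by rewrite size_iota (leq_ltn_trans _ lak)// la_le.
have sh_lt T (i : 'I_n) j : semistandard_fun n.+1 la (entry T) -> (j < nth 0 la i)%N ->
    (entry T (val i, j) < n)%N = (j < sh T i)%N.
  move=> [row _ _] jla; rewrite shE.
  apply: (@count_iota_initial (fun j => (entry T (val i, j) < n)%N)) => // a b ab b_la.
  by apply: leq_ltn_trans; apply: row.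
(* Columns are strict, so an entry of row i is at least i; row n can only contain n and disappears
   from the smaller shape. *)
have row_n T j : semistandard_fun n.+1 la (entry T) -> (j < nth 0 la n)%N -> entry T (n, j) = n.
  move=> [_ col bnd] jla; apply/eqP; rewrite eqn_leq -ltnS bnd//=.
  have : forall i, (i <= n)%N -> (i <= entry T (i, j))%N.
    elim=> // i IH i_n; apply: leq_ltn_trans (IH (ltnW i_n)) _.
    by apply: col => //; apply: leq_trans jla _; apply: la_le => //; exact: ltnW.
  by apply.
have sh_interlacing T : bounded_tableau n.+1 T -> interlacing la (sh T).
  move/bounded_tableauP => sT; have [_ col bnd] := sT; apply/forallP => i.
  apply/andP; split; last by rewrite shE (leq_trans (count_size _ _))// size_iota.
  rewrite leqNgt; apply/negP => lt_i.
  have h := leq_trans lt_i (la_le _ _ (leqnSn i)).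
  have := sh_lt T i _ sT h; rewrite ltnn => /negbT/negP; apply.
  have := col i i.+1 _ (ltnSn i) h lt_i => /leq_trans; apply.
  by rewrite -ltnS bnd.
rewrite /tableau_sum (partition_big sh (interlacing la))//=; apply: eq_bigr => f ilf.
have f_le (i : 'I_n) : (nth 0 la i.+1 <= f i <= nth 0 la i)%N by have /forallP := ilf; apply.
(* [res] forgets the entries n and [ext] restores them: inverse bijections between the tableaux T
   with [sh T = f] and the tableaux of shape [fseq f]. *)
pose res (T : {ffun seq_sub (diagram la) -> 'I_M.+1}) := fill (fseq f) (entry T).
pose ext_fun (T : {ffun seq_sub (diagram (fseq f)) -> 'I_M.+1}) b :=
  if b \in diagram (fseq f) then entry T b else n.
pose ext (T : {ffun seq_sub (diagram (fseq f)) -> 'I_M.+1}) := fill la (ext_fun T).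
have fD i j : ((i, j) \in diagram (fseq f)) -> exists i' : 'I_n, i = i' /\ (j < f i')%N.
  rewrite mem_diagram => h; have i_n : (i < n)%N.
    by rewrite -(size_fseq f) ltnNge; apply: contraTN h => /(nth_default 0%N) ->.
  by exists (Ordinal i_n); split=> //; rewrite -nth_fseq.
have sub b : b \in diagram (fseq f) -> b \in diagram la.
  case: b => i j /fD[i' [-> h]]; rewrite mem_diagram; apply: leq_trans h _.
  by case/andP: (f_le i').
have ext_le T b : (ext_fun T b <= M)%N.
  by rewrite /ext_fun; case: ifP => // _; exact: entry_le.
have entry_ext T b : b \in diagram la -> entry (ext T) b = ext_fun T b.
  by move=> bla; rewrite entry_fill.
have entry_res T b : b \in diagram (fseq f) -> entry (res T) b = entry T b.
  by move=> bla; rewrite entry_fill// entry_le.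
have f_box i j : (j < nth 0 (fseq f) i)%N -> (i, j) \in diagram (fseq f).
  by rewrite mem_diagram.
have f_la i j : (j < nth 0 (fseq f) i)%N -> (j < nth 0 la i)%N.
  by move/f_box/sub; rewrite mem_diagram.
have f_row i j : (j < nth 0 (fseq f) i)%N -> exists i' : 'I_n, i = i' /\ (j < f i')%N.
  by move/f_box/fD.
have res_ok T : bounded_tableau n.+1 T -> sh T = f -> bounded_tableau n (res T).
  move=> /bounded_tableauP sT shT; have [row col bnd] := sT.
  apply/bounded_tableauP; split=> [i j j' jj' j'f|i i' j ii' jf jf'|i j jf].
  - rewrite !entry_res; [|exact/f_box|exact/f_box/(leq_ltn_trans jj')].
    by apply: row => //; apply: f_la.
  - rewrite !entry_res; [|exact/f_box|exact/f_box].
    by apply: col => //; apply: f_la.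
  rewrite entry_res; last exact/f_box.
  have [i' [ii' ji']] := f_row _ _ jf; have := f_la _ _ jf; rewrite ii' => jla.
  by rewrite sh_lt// shT.
have ext_res T : bounded_tableau n.+1 T -> sh T = f -> ext (res T) = T.
  move=> /bounded_tableauP sT shT; have [row col bnd] := sT.
  rewrite -[RHS]fillK; apply/ffunP => -[[i j] ij]; rewrite !ffunE /=; congr inord.
  have jla : (j < nth 0 la i)%N by rewrite -mem_diagram.
  rewrite /ext_fun; case: ifPn => [bf|nbf]; first exact: entry_res.
  have := la_row _ _ jla; rewrite leq_eqVlt => /predU1P[i_n|i_n].
    by rewrite i_n in jla *; rewrite row_n.
  apply/eqP; rewrite eqn_leq -[(_ <= n)%N]ltnS bnd// andbT.
  rewrite leqNgt (sh_lt T (Ordinal i_n) j sT jla) shT.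
  by move: nbf; rewrite mem_diagram (nth_fseq f (Ordinal i_n)).
have ext_ok T : bounded_tableau n T -> bounded_tableau n.+1 (ext T).
  move=> /bounded_tableauP[row col bnd].
  have ext_n b : (ext_fun T b <= n)%N.
    rewrite /ext_fun; case: b => i j; case: ifPn => //; rewrite mem_diagram => h.
    exact/ltnW/bnd.
  apply/bounded_tableauP; split=> [i j j' jj' j'la|i i' j ii' jla jla'|i j jla].
  - rewrite !entry_ext ?mem_diagram//; last exact: leq_ltn_trans j'la.
    rewrite {2}/ext_fun; case: ifPn => [bf|_]; last exact: ext_n.
    rewrite mem_diagram in bf; rewrite /ext_fun f_box ?(leq_ltn_trans jj')//.
    exact: row.
  - rewrite !entry_ext ?mem_diagram//.
    have i_n : (i < n)%N by apply: leq_trans ii' (la_row _ _ jla').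
    have jf : (j < nth 0 (fseq f) i)%N.
      rewrite (nth_fseq f (Ordinal i_n)); case/andP: (f_le (Ordinal i_n)) => h _.
      exact: leq_trans (leq_trans jla' (la_le _ _ ii')) h.
    rewrite {1}/ext_fun f_box//.
    rewrite /ext_fun; case: ifPn => [bf|_]; last exact: bnd.
    by rewrite mem_diagram in bf; apply: col.
  by rewrite entry_ext ?mem_diagram// ltnS.
have sh_ext T : bounded_tableau n T -> sh (ext T) = f.
  move=> /bounded_tableauP[_ _ bnd]; apply/ffunP => i; apply: val_inj; rewrite /= shE.
  have fi : (f i <= nth 0 la i)%N by case/andP: (f_le i).
  rewrite (@eq_in_count _ _ (fun j => (j < f i)%N)) => [|j]; last first.
    rewrite mem_iota /= add0n => jla; rewrite entry_ext ?mem_diagram// /ext_fun.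
    rewrite mem_diagram nth_fseq; case: (ltnP j (f i)) => [jf|_]; last by rewrite ltnn.
    by rewrite bnd// nth_fseq.
  have := @count_iota_initial (fun j => (j < f i)%N) (nth 0 la i)
    (fun a b ab _ => leq_ltn_trans ab).
  set c := count _ _ => cE; apply/eqP; case: ltngtP => // h.
    by have := cE c (leq_trans h fi); rewrite /= h ltnn.
  have f_lt : (f i < nth 0 la i)%N.
    by apply: leq_trans h _; rewrite /c (leq_trans (count_size _ _))// size_iota.
  by have := cE (f i) f_lt; rewrite /= ltnn h.
have res_ext T : res (ext T) = T.
  rewrite -[RHS]fillK; apply/ffunP => -[b bf]; rewrite !ffunE /= entry_ext ?sub//.
  by rewrite /ext_fun bf.
rewrite (reindex_onto ext res) /=; last by move=> T /andP[oT /eqP shT]; exact: ext_res.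
rewrite big_distrr /=; apply: eq_big => [T|T /andP[/andP[oT shT] _]].
  rewrite res_ext eqxx andbT; apply/andP/idP => [[oT /eqP shT]|oT].
    by rewrite -[T]res_ext; exact: res_ok.
  by split; [exact: ext_ok|apply/eqP/sh_ext].
rewrite (prod_entry _ lan) (@prod_entry _ n T) ?size_fseq// big_ord_recr /= mulrC.
rewrite exprD -mulrA; congr (_ * _).
  rewrite (eq_big_nat _ _ (F2 := fun=> x n)) => [|j /andP[_ jla]].
    by rewrite prodr_const_nat subn0.
  by rewrite row_n//; apply/bounded_tableauP.
rewrite expr_sum -big_split; apply: eq_bigr => i _ /=.
have /andP[_ fi] := f_le i.
rewrite (big_cat_nat _ fi)//= mulrC nth_fseq; congr (_ * _).
  rewrite (eq_big_nat _ _ (F2 := fun=> x n)) => [|j /andP[fj jla]].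
    by rewrite prodr_const_nat.
  by rewrite entry_ext ?mem_diagram// /ext_fun mem_diagram nth_fseq ltnNge fj.
apply: eq_big_nat => j /andP[_ jf].
rewrite entry_ext ?mem_diagram ?(leq_trans jf)//.
by rewrite /ext_fun mem_diagram nth_fseq jf.
Qed.

End Tableaux.

(** * The identity in finitely many variables *)

Section Bialternant.
Variables (R : comNzRingType) (x : nat -> R) (M : nat).

Lemma tableau_sum_nil : tableau_sum M x 0 [::] = 1.
Proof.
rewrite /tableau_sum (big_pred1 (fill M [::] (fun=> 0%N))) => [|T].
  by rewrite big1// => -[b bD].
have -> : T = fill M [::] (fun=> 0%N) by apply/ffunP => -[b bD].
rewrite /= eqxx; apply/bounded_tableauP.
by split=> [i j j' _|i i' j _|i j]; rewrite nth_nil.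
Qed.

Lemma interlacing_sorted n k la (f : {ffun 'I_n -> 'I_k}) :
  interlacing la f -> sorted geq (fseq f).
Proof.
move=> /forallP h; apply/(sortedP 0%N) => i; rewrite size_fseq => i_n.
rewrite (nth_fseq f (Ordinal i_n)) (nth_fseq f (Ordinal (ltnW i_n))) /=.
case/andP: (h (Ordinal i_n)) => _ h1; case/andP: (h (Ordinal (ltnW i_n))) => h2 _.
exact: leq_trans h1 h2.
Qed.

Lemma part_alternant_nilS n :
  part_alternant x n.+1 [::] = (\prod_(i < n) (x i - x n)) * part_alternant x n [::].
Proof.
rewrite (@alternant_branch _ x n 1 [::])//; congr (_ * _).
rewrite (big_pred1 [ffun=> ord0]) => [|f].
  rewrite nth_nil big1 => [|i _]; last by rewrite nth_nil.
  by rewrite expr0 mul1r; apply: eq_alternant => i; rewrite /beta nth_fseq ffunE nth_nil.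
have -> : f = [ffun=> ord0] by apply/ffunP => i; rewrite !ffunE; exact: ord1.
by rewrite /= eqxx; apply/forallP => i; rewrite ffunE !nth_nil.
Qed.

(** Both sides obey the same recursion in n, the product in [alternant_branch] being the factor
    gained by the Vandermonde determinant in [part_alternant_nilS]. *)
Lemma bialternant n la : (n <= M.+1)%N -> sorted geq la -> (size la <= n)%N ->
  part_alternant x n la = tableau_sum M x n la * part_alternant x n [::].
Proof.
elim: n la => [|n IH] la nM sla lan.
  have -> : la = [::] by case: la lan sla.
  by rewrite tableau_sum_nil mul1r.
rewrite (@alternant_branch _ x n (nth 0%N la 0).+1 la)//.
rewrite (@tableau_sum_branch M _ x n (nth 0%N la 0).+1 la)//.
rewrite part_alternant_nilS mulrCA; congr (_ * _); rewrite big_distrl.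
apply: eq_bigr => f /interlacing_sorted sf /=; rewrite -mulrA IH ?size_fseq//.
exact: ltnW.
Qed.

(** The Vandermonde determinant is a product of differences of variables. Regularity is what
    cancellation requires, as R need not be a domain. *)
Lemma part_alternant_lreg n : (forall i j, (i < j)%N -> GRing.lreg (x i - x j)) ->
  GRing.lreg (part_alternant x n [::]).
Proof.
move=> reg; elim: n => [|n IH].
  by rewrite /part_alternant /alternant det_mx00; exact: lreg1.
rewrite part_alternant_nilS; apply: lregM => //.
apply: (big_ind (@GRing.lreg R)) => [||i _]; [exact: lreg1|exact: lregM|].
exact: reg.
Qed.

(** * Partitions and decreasing bead sequences *)

Definition part_of_beads n k (c : {ffun 'I_n -> 'I_k}) : seq nat :=
  strip_zeros (mkseq (fun i => nth 0%N (fseq c) i - (n - i.+1))%N n).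

(** There are n - 1 - i distinct smaller beads. Hence the subtraction in [part_of_beads] is never
    truncated. *)
Lemma decreasing_ge n k (c : {ffun 'I_n -> 'I_k}) (i : 'I_n) :
  decreasing c -> (n - i.+1 <= c i)%N.
Proof.
move=> /decreasingP dc; have [p] := ubnP (n - i.+1); elim: p i => // p IH i hp.
case: (ltnP i.+1 n) => [i_n|]; last by lia.
have := IH (Ordinal i_n); have := dc i (Ordinal i_n) (ltnSn i) => /=; lia.
Qed.

Lemma sorted_beads n k (c : {ffun 'I_n -> 'I_k}) : decreasing c ->
  sorted geq (mkseq (fun i => nth 0%N (fseq c) i - (n - i.+1))%N n).
Proof.
move=> dc; apply/(sortedP 0%N) => i; rewrite size_mkseq => i_n.
rewrite !nth_mkseq//; last exact: ltnW.
rewrite (nth_fseq c (Ordinal i_n)) (nth_fseq c (Ordinal (ltnW i_n))).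
have := decreasingP _ dc (Ordinal (ltnW i_n)) (Ordinal i_n) (ltnSn i) => /=; lia.
Qed.

Lemma is_part_of_beads n k (c : {ffun 'I_n -> 'I_k}) :
  decreasing c -> is_part (part_of_beads c).
Proof. by move=> dc; apply/is_part_strip_zeros/sorted_beads. Qed.

Lemma size_part_of_beads n k (c : {ffun 'I_n -> 'I_k}) : (size (part_of_beads c) <= n)%N.
Proof. by rewrite size_filter (leq_trans (count_size _ _))// size_mkseq. Qed.

Lemma beta_part_of_beads n k (c : {ffun 'I_n -> 'I_k}) (i : 'I_n) :
  decreasing c -> beta n (part_of_beads c) i = c i.
Proof.
move=> dc; rewrite /beta nth_strip_zeros ?sorted_beads// nth_mkseq// nth_fseq.
by rewrite subnK// decreasing_ge.
Qed.

Lemma sumn_part_of_beads n k (c : {ffun 'I_n -> 'I_k}) : decreasing c ->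
  (sumn (part_of_beads c) + \sum_(i < n) (n - i.+1))%N = weight (fun i => c i).
Proof.
move=> dc; rewrite -sum_beta ?size_part_of_beads//.
by apply: eq_bigr => i _; rewrite beta_part_of_beads.
Qed.

Lemma part_of_beads_inj n k (c d : {ffun 'I_n -> 'I_k}) :
  decreasing c -> decreasing d -> part_of_beads c = part_of_beads d -> c = d.
Proof.
move=> dc dd cd; apply/ffunP => i; apply: val_inj.
by rewrite /= -!beta_part_of_beads// cd.
Qed.

Lemma size_is_part la : is_part la -> (size la <= sumn la)%N.
Proof.
case/andP=> _; elim: la => //= a la IH; rewrite inE negb_or eq_sym -lt0n => /andP[a0 /IH].
by rewrite -add1n; exact: leq_add.
Qed.

Lemma part_of_beads_onto n k la : is_part la -> (size la <= n)%N ->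
  (sumn la + \sum_(i < n) (n - i.+1) < k)%N ->
  exists2 c : {ffun 'I_n -> 'I_k}, decreasing c & part_of_beads c = la.
Proof.
move=> pla lan; case: k => // k lak.
have lt_k (i : 'I_n) : (beta n la i < k.+1)%N.
  by apply: leq_ltn_trans lak; rewrite -sum_beta// (bigD1 i)//= leq_addr.
pose c : {ffun 'I_n -> 'I_k.+1} := [ffun i : 'I_n => inord (beta n la i)].
have cE i : c i = beta n la i :> nat by rewrite ffunE inordK.
have dc : decreasing c.
  by apply/decreasingP => i j ij; rewrite !cE beta_decr.
exists c => //; apply: is_part_inj => [||i]; [exact: is_part_of_beads|by []|].
case: (ltnP i n) => i_n; last first.
  rewrite !nth_default//; first exact: leq_trans i_n.
  exact: leq_trans (size_part_of_beads _) i_n.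
have := beta_part_of_beads (Ordinal i_n) dc; rewrite cE /beta /=.
exact: addIn.
Qed.

(** After multiplication by the regular Vandermonde determinant this is [alternant_pieri], with
    [bialternant] applied to each Schur polynomial. The bound on the size ensures that every
    partition in [s] has at most n + 1 parts, hence a bead sequence. *)
Lemma tableau_sum_pieri n r m nu (s : seq (seq nat)) : (n <= M)%N -> (0 < r)%N ->
  (forall i j, (i < j)%N -> GRing.lreg (x i - x j)) ->
  is_part nu -> (r * m + sumn nu <= n.+1)%N -> uniq s ->
  (forall la, (la \in s) = is_part la && (sumn la == r * m + sumn nu)%N) ->
  tableau_sum M x n.+1 nu * power_complete x r m n.+1 =
  \sum_(la <- s) tableau_sum M x n.+1 la *~ sgn_r r la nu.
Proof.
move=> nM r_gt0 reg pnu le_n us sE.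
have nun : (size nu <= n.+1)%N.
  by apply: leq_trans (size_is_part pnu) (leq_trans _ le_n); exact: leq_addl.
have sp la : is_part la -> sorted geq la by case/andP.
pose D := (\sum_(i < n.+1) (n.+1 - i.+1))%N.
(* [D] is the weight of the staircase, so [k] exceeds the total of the beads of any partition in
   [s], and each of these beads fits in ['I_k]. *)
pose k := (r * m + sumn nu + D).+1.
have wE : weight (fun i : 'I_n.+1 => beta n.+1 nu i) = (sumn nu + D)%N.
  exact: sum_beta.
apply: (@part_alternant_lreg n.+1 reg); rewrite mulrA [X in X * _ = _]mulrC -bialternant ?sp//.
have lt_k : (weight (fun i : 'I_n.+1 => beta n.+1 nu i) + r * m < k)%N.
  by rewrite wE /k; lia.
rewrite /part_alternant (@alternant_pieri _ x r m n.+1 k _ (beta n.+1 nu) r_gt0 lt_k)//.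
pose e := [seq c <- index_enum {ffun 'I_n.+1 -> 'I_k} |
  decreasing c && (weight (fun i => c i) == sumn nu + D + r * m)%N].
have pe : perm_eq s [seq part_of_beads c | c <- e].
  apply: uniq_perm => // [|la].
    rewrite map_inj_in_uniq ?filter_uniq ?index_enum_uniq// => c d.
    by rewrite !mem_filter => /andP[/andP[dc _] _] /andP[/andP[dd _] _]; exact: part_of_beads_inj.
  rewrite sE; apply/andP/mapP => [[pla /eqP sla]|[c]].
    have [||c dc la_c] := @part_of_beads_onto n.+1 k la pla.
    - by rewrite (leq_trans (size_is_part pla))// sla.
    - by rewrite sla /k.
    exists c => //; rewrite mem_filter dc mem_index_enum andbT /=.
    by rewrite -sumn_part_of_beads// la_c sla -/D; apply/eqP; lia.
  rewrite mem_filter => /andP[/andP[dc /eqP wc] _] ->; split; first exact: is_part_of_beads.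
  by have := sumn_part_of_beads dc; rewrite wc -/D; lia.
rewrite (perm_big _ pe) big_map big_filter big_distrr /= wE.
apply: eq_bigr => c /andP[dc _].
rewrite mulrzAr mulrC -bialternant ?size_part_of_beads ?sp ?is_part_of_beads//.
rewrite (sgn_r_det r_gt0 pnu (is_part_of_beads dc) nun (size_part_of_beads _)).
have -> : part_alternant x n.+1 (part_of_beads c) = alternant x (fun i => c i).
  by apply: eq_alternant => i; rewrite beta_part_of_beads.
have -> // : move_mx r n.+1 (beta n.+1 nu) (beta n.+1 (part_of_beads c)) =
  move_mx r n.+1 (beta n.+1 nu) (nth 0%N (fseq c)).
by apply/matrixP => i j; rewrite !mxE nth_fseq beta_part_of_beads.
Qed.

End Bialternant.

(** * Passage to infinitely many variables *)

Local Open Scope mset_scope.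
Local Open Scope ring_scope.

Definition monomial (b : {mset nat}) : series := fun a => (a == b)%:R.

Definition Xvar (i : nat) : series := monomial [mset i]%mset.

Lemma monomial_mulD b (f : series) a : (monomial b * f) (b `+` a)%mset = f a.
Proof.
have [s [us sP]] := msubset_seq (b `+` a)%mset.
have ba : (b `<=` b `+` a)%mset by apply/msubsetP => i; rewrite msetE2 leq_addr.
have ab : (a `<=` b `+` a)%mset by apply/msubsetP => i; rewrite msetE2 leq_addl.
rewrite [LHS](series_mulE _ _ us) => [|c]; last by rewrite sP.
rewrite (bigD1_seq b) ?sP//= [X in _ + X]big1 ?addr0 => [|c /negPf cb]; last first.
  by rewrite big1// => d _; rewrite /monomial cb mul0r.
rewrite big_mkcond (bigD1_seq a) ?sP//= big1 => [|c /negPf ca].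
  by rewrite addr0 eqxx /monomial eqxx mul1r.
by rewrite (inj_eq (can_inj (msetDKB b))) ca.
Qed.

Lemma monomial_mul_eq0 b (f : series) a : ~~ (b `<=` a)%mset -> (monomial b * f) a = 0.
Proof.
move=> nba; have [s [us sP]] := msubset_seq a.
rewrite [LHS](series_mulE _ _ us) => [|c]; last by rewrite sP.
rewrite big1_seq// => c /andP[_]; rewrite sP => ca; rewrite big1// => d _.
have -> : monomial b c = 0; last by rewrite mul0r.
by rewrite /monomial; case: eqP nba => // <-; rewrite ca.
Qed.

Lemma monomialD b c : monomial (b `+` c)%mset = monomial b * monomial c.
Proof.
apply: funext => a; have [ba|nba] := boolP (b `<=` a)%mset; last first.
  rewrite monomial_mul_eq0// /monomial; case: eqP nba => // -> /negP[].
  by apply/msubsetP => i; rewrite msetE2 leq_addr.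
rewrite -[a](msetBDKC ba) monomial_mulD /monomial.
by rewrite (inj_eq (can_inj (msetDKB b))).
Qed.

Lemma monomial0 : monomial mset0%mset = 1.
Proof. by []. Qed.

Lemma prod_Xvar s : \prod_(i <- s) Xvar i = monomial (seq_mset s).
Proof.
elim: s => [|i s IH]; last by rewrite big_cons IH mset_cons monomialD.
by rewrite big_nil -monomial0; congr monomial; apply/msetP => j; rewrite mset_seqE mset0E.
Qed.

Lemma series_sumE (I : Type) (r : seq I) (P : pred I) (F : I -> series) a :
  (\sum_(i <- r | P i) F i) a = \sum_(i <- r | P i) F i a.
Proof. by apply: (big_morph (fun f : series => f a)). Qed.

Lemma series_mulrzE (f : series) (z : int) a : (f *~ z) a = f a *~ z.
Proof.
have natE k : (f *+ k) a = f a *+ k.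
  by elim: k => // k IH; rewrite !mulrS -IH.
by case: z => k; rewrite ?NegzE ?mulrNz -?pmulrn -?natE.
Qed.

(** If X_i f = X_j f, the coefficient of f at a equals the one at a with a factor x_j exchanged for
    x_i. Repeating this exhausts the x_j, and then the coefficient is 0. *)
Lemma Xvar_sub_lreg i j : (i < j)%N -> GRing.lreg (Xvar i - Xvar j).
Proof.
move=> ij; apply: mulrI0_lreg => f; rewrite mulrBl => /eqP; rewrite subr_eq0 => /eqP E.
have E' a : f a = (Xvar j * f) (i +` a)%mset by rewrite -E monomial_mulD.
apply: funext => a; change (f a = 0).
have [n] : exists n, (a j < n)%N by exists (a j).+1.
elim: n a => [a|n IH a ajn]; first by rewrite ltn0; case/notF.
have [aj|] := boolP (j \in a); last first.
  rewrite -mset_eq0 => /eqP aj; rewrite E'; apply: monomial_mul_eq0.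
  apply/negP => /msubsetP/(_ j); rewrite msetnxx mset1DE aj addn0.
  by rewrite (gtn_eqF ij).
have /msetP aE := msetB1K aj.
rewrite E'; have -> : (i +` a = j +` (i +` (a `\ j)))%mset.
  by rewrite msetDCA msetB1K.
rewrite monomial_mulD; apply: IH; rewrite mset1DE (gtn_eqF ij) add0n.
by have := aE j; rewrite mset1DE eqxx => h; move: ajn; rewrite -h add1n.
Qed.

(** Only divisors of the monomial a enter its coefficient in a product. This permits replacing both
    factors by polynomials in finitely many variables. *)
Lemma eq_series_mul (f f' g g' : series) a :
  (forall b, (b `<=` a)%mset -> f b = f' b) ->
  (forall b, (b `<=` a)%mset -> g b = g' b) -> (f * g) a = (f' * g') a.
Proof.
move=> ff gg; have [s [us sP]] := msubset_seq a.
rewrite [LHS](series_mulE _ _ us) => [|c]; last by rewrite sP.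
rewrite [RHS](series_mulE _ _ us) => [|c]; last by rewrite sP.
rewrite big_seq [RHS]big_seq; apply: eq_bigr => b bs.
rewrite big_seq_cond [RHS]big_seq_cond; apply: eq_bigr => c /andP[cs _].
by rewrite ff -?sP// gg -?sP.
Qed.

(** A tableau of content a has its entries in the support of a, thus below n. *)
Lemma schur_tableau_sum M n la (a : {mset nat}) :
  (n <= M.+1)%N -> (forall i, (n <= i)%N -> a i = 0%N) ->
  schur la a = tableau_sum M Xvar n la a.
Proof.
move=> nM an; pose v (T : {ffun seq_sub (diagram la) -> 'I_M.+1}) :
  {ffun seq_sub (diagram la) -> nat} := [ffun b => T b : nat].
have v_inj : injective v.
  by move=> T T' /ffunP h; apply/ffunP => b; apply: val_inj; have := h b; rewrite !ffunE.
pose r := [seq v T | T <- index_enum {ffun seq_sub (diagram la) -> 'I_M.+1} &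
  bounded_tableau n T && (seq_mset (codom (v T)) == a)].
have ur : uniq r by rewrite map_inj_uniq// filter_uniq// index_enum_uniq.
rewrite /schur; have -> : [set T : {ffun seq_sub (diagram la) -> nat} |
    semistandard T /\ seq_mset (codom T) = a]%classic = [set` r]%classic.
  apply/seteqP; split=> T /=; last first.
    by case/mapP=> T'; rewrite mem_filter => /andP[/andP[/andP[sT _] /eqP Ta] _] ->.
  case=> sT Ta.
  have T_n b : (T b < n)%N.
    rewrite ltnNge; apply/negP => /an/eqP; apply/negP.
    rewrite -lt0n mset_gt0 -Ta (perm_mem (perm_eq_seq_mset _)); exact: codom_f.
  have vT : v [ffun b => inord (T b)] = T.
    by apply/ffunP => b; rewrite !ffunE inordK// (leq_trans (T_n b)).
  apply/mapP; exists [ffun b => inord (T b)]; last by rewrite vT.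
  rewrite mem_filter mem_index_enum andbT vT Ta eqxx andbT.
  rewrite /bounded_tableau -/(v _) vT sT /=; apply/forallP => b.
  by rewrite ffunE inordK// (leq_trans (T_n b)).
rewrite -fsbig_seq// big_map big_filter /tableau_sum series_sumE big_mkcondr /=.
apply: eq_bigr => T _.
have -> : \prod_b Xvar (T b) = monomial (seq_mset (codom (v T))).
  rewrite -prod_Xvar /codom /image_mem big_map big_enum.
  by apply: eq_bigr => b _; rewrite ffunE.
by rewrite /monomial eq_sym; case: eqP.
Qed.

(** A multiset of m entries fills a single row in exactly one way, in increasing order. *)
Lemma complete_coef m (b : {mset nat}) : complete m b = (size b == m)%:R.
Proof.
have us : uniq (diagram [:: m]) by exact: diagram_uniq.
have dE : diagram [:: m] = [seq (0%N, j) | j <- iota 0 m] by rewrite /diagram /= cats0.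
have pe : perm_eq [seq ssval u | u <- enum {: seq_sub (diagram [:: m])}] (diagram [:: m]).
  apply: uniq_perm => // [|c]; first by rewrite map_inj_uniq ?enum_uniq//; exact: val_inj.
  apply/mapP/idP => [[u _ ->]|cD]; first exact: ssvalP.
  by exists (SeqSub cD); rewrite ?mem_enum.
have codomE (T : {ffun seq_sub (diagram [:: m]) -> nat}) (e : box -> nat) :
    (forall u, T u = e (ssval u)) -> perm_eq (codom T) [seq e (0%N, j) | j <- iota 0 m].
  move=> Te; rewrite [X in perm_eq _ X](_ : _ = map e (diagram [:: m])).
    apply: perm_trans (perm_map e pe); rewrite -map_comp.
    by rewrite (eq_map (g := T)) => [//|u]; rewrite Te.
  by rewrite dE -map_comp.
pose e (T : {ffun seq_sub (diagram [:: m]) -> nat}) (c : box) :=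
  if insub c is Some u then T u else 0%N.
have Te (T : {ffun seq_sub (diagram [:: m]) -> nat}) u : T u = e T (ssval u).
  by rewrite /e (_ : insub _ = Some u)//; exact: valK.
have card_b (T : {ffun seq_sub (diagram [:: m]) -> nat}) : seq_mset (codom T) = b -> size b = m.
  move=> <-; rewrite (perm_size (perm_eq_seq_mset _)).
  by rewrite (perm_size (codomE _ _ (Te T))) size_map size_iota.
rewrite /complete /schur; case: eqP => [bm|nbm]; last first.
  rewrite (_ : [set _ | _]%classic = set0) ?fsbig_set0//.
  by apply/seteqP; split=> T //= -[_ /card_b].
pose S := sort leq b.
have sizeS : size S = m by rewrite size_sort.
pose T0 : {ffun seq_sub (diagram [:: m]) -> nat} := [ffun u => nth 0%N S (ssval u).2].
rewrite (_ : [set _ | _]%classic = [set T0]%classic) ?fsbig_set1//.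
apply/seteqP; split=> T /=; last first.
  move=> ->; split.
    apply/forallP => -[[i j] ij]; apply/forallP => -[[i' j'] ij'] /=; rewrite !ffunE /=.
    have row k l : (k, l) \in diagram [:: m] -> k = 0%N /\ (l < m)%N.
      by rewrite dE => /mapP[q]; rewrite mem_iota => qm [-> ->].
    have [-> jm] := row _ _ ij; have [-> jm'] := row _ _ ij'.
    rewrite ltnn andbF /= andbT; apply/implyP => jj'.
    apply: (sorted_leq_nth leq_trans leqnn 0%N (sort_sorted leq_total b)) => //.
      by rewrite inE -/S sizeS.
    by rewrite inE -/S sizeS.
  rewrite -[RHS]seq_mset_id; apply/eq_seq_msetP.
  apply: perm_trans (codomE _ (fun c => nth 0%N S c.2) _) _ => [u|]; first by rewrite ffunE.
  by rewrite -sizeS -/(mkseq _ _) mkseq_nth perm_sort.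
case=> /forallP sT Tb; have pS : [seq e T (0%N, j) | j <- iota 0 m] = S.
  apply: (sorted_eq leq_trans anti_leq) (sort_sorted leq_total b) _.
    apply/(sortedP 0%N) => j; rewrite size_map size_iota => jm.
    have jm' := ltnW jm; rewrite !(nth_map 0%N) ?size_iota// !nth_iota// !add0n.
    have D k : (k < m)%N -> (0%N, k) \in diagram [:: m] by rewrite mem_diagram.
    have /forallP/(_ (SeqSub (D _ jm)))/andP[+ _] := sT (SeqSub (D _ jm')).
    by rewrite /= !Te /= leqnSn.
  apply: perm_trans (_ : perm_eq _ (codom T)) _; first by rewrite perm_sym codomE.
  by rewrite perm_sym perm_sort -Tb perm_eq_seq_mset.
apply/ffunP => u; rewrite ffunE Te -pS.
move: (ssval u) (ssvalP u) => c; rewrite dE => /mapP[j]; rewrite mem_iota add0n => jm ->.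
by rewrite (nth_map 0%N) ?size_iota// nth_iota.
Qed.

Definition exponent_seq n (g : 'I_n -> nat) : seq nat :=
  flatten [seq nseq (g i) (val i) | i <- enum 'I_n].

Lemma size_exponent_seq n (g : 'I_n -> nat) : size (exponent_seq g) = weight g.
Proof.
rewrite size_flatten /shape -map_comp sumnE big_map big_enum.
by apply: eq_bigr => i _; rewrite /= size_nseq.
Qed.

Lemma count_exponent_seq n (g : 'I_n -> nat) j :
  count_mem j (exponent_seq g) = (\sum_(i < n) (val i == j) * g i)%N.
Proof.
rewrite count_flatten -map_comp sumnE big_map big_enum.
by apply: eq_bigr => i _; rewrite /= count_nseq.
Qed.

Lemma exponent_seqE n (g : 'I_n -> nat) (i : 'I_n) :
  seq_mset (exponent_seq g) i = g i.
Proof.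
rewrite mset_seqE count_exponent_seq (bigD1 i)//= eqxx mul1n big1 ?addn0// => j.
by rewrite -val_eqE => /negPf ->.
Qed.

Lemma exponent_seq0 n (g : 'I_n -> nat) j : (n <= j)%N ->
  seq_mset (exponent_seq g) j = 0%N.
Proof.
move=> nj; rewrite mset_seqE count_exponent_seq big1// => i _.
by rewrite ltn_eqF// (leq_trans (ltn_ord i)).
Qed.

Lemma prod_Xvar_exponent n (g : 'I_n -> nat) :
  \prod_(i < n) Xvar i ^+ g i = monomial (seq_mset (exponent_seq g)).
Proof.
rewrite -prod_Xvar big_flatten big_map big_enum; apply: eq_bigr => i _.
by rewrite big_nseq iter_mulr_1.
Qed.

Lemma exponent_seq_eq n (g : 'I_n -> nat) (a : {mset nat}) :
  (forall i, (n <= i)%N -> a i = 0%N) ->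
  (a == seq_mset (exponent_seq g)) = [forall i : 'I_n, a i == g i].
Proof.
move=> an; apply/eqP/forallP => [-> i|ag]; first by rewrite exponent_seqE.
apply/msetP => i; case: (ltnP i n) => [i_n|ni]; last by rewrite exponent_seq0 ?an.
by rewrite (exponent_seqE g (Ordinal i_n)) -(eqP (ag (Ordinal i_n))).
Qed.

(** A monomial has at most one r-th root, with exponents a_i / r; both coefficients are 1 if it
    exists and has degree m, and 0 otherwise. *)
Lemma power_plethysm_complete r m n (a : {mset nat}) : (0 < r)%N ->
  (forall i, (n <= i)%N -> a i = 0%N) ->
  power_plethysm r (complete m) a = power_complete Xvar r m n a.
Proof.
move=> r_gt0 an; rewrite /power_complete series_sumE.
under eq_bigr => f _ do
  rewrite prod_Xvar_exponent /monomial (exponent_seq_eq (fun i => r * f i)%N an).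
rewrite /power_plethysm.
have [/forallP ra|] := boolP [forall i : 'I_n, (r %| a i)%N]; last first.
  rewrite negb_forall => /existsP[i nra].
  rewrite (_ : [set _ | _]%classic = set0) ?fsbig_set0; last first.
    by apply/seteqP; split=> b //= ab; rewrite (ab i) dvdn_mulr in nra.
  rewrite big1// => f _; case: forallP => // /(_ i) /eqP ai.
  by rewrite ai dvdn_mulr in nra.
pose g (i : 'I_n) := (a i %/ r)%N.
have ag i : a (val i) = (r * g i)%N by rewrite /g mulnC divnK.
rewrite (_ : [set _ | _]%classic = [set seq_mset (exponent_seq g)]%classic); last first.
  apply/seteqP; split=> b /= => [ab|->].
    apply/eqP; rewrite exponent_seq_eq => [|i /an]; last first.
      by rewrite ab => /eqP; rewrite muln_eq0 gtn_eqF//= => /eqP.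
    by apply/forallP => i; rewrite -(eqn_pmul2l r_gt0) -ab ag.
  move=> i; case: (ltnP i n) => [i_n|ni]; last by rewrite exponent_seq0// an ?muln0.
  by rewrite (exponent_seqE g (Ordinal i_n)) -ag.
rewrite fsbig_set1 complete_coef (perm_size (perm_eq_seq_mset _)) size_exponent_seq.
have [wg|wg] := eqVneq (weight g) m; last first.
  rewrite big1// => f /eqP wf; case: forallP => // fa; case/eqP: wg; rewrite -wf.
  apply: eq_bigr => i _; apply/eqP; rewrite -(eqn_pmul2l r_gt0) -ag; exact: fa.
pose f0 : {ffun 'I_n -> 'I_m.+1} := [ffun i => inord (g i)].
have f0E i : f0 i = g i :> nat.
  by rewrite ffunE inordK// ltnS -wg /weight (bigD1 i)//= leq_addr.
rewrite (bigD1 f0) /=; last by rewrite -[X in _ == X]wg; apply/eqP/eq_bigr => i _.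
rewrite (_ : [forall i, _] = true); last by apply/forallP => i; rewrite f0E ag.
rewrite big1 ?addr0// => f /andP[_ ff0]; case: forallP => // fa; case/eqP: ff0.
apply/ffunP => i; apply: val_inj; rewrite /= f0E; apply/eqP.
by rewrite -(eqn_pmul2l r_gt0) -ag eq_sym; exact: fa.
Qed.

Local Open Scope classical_set_scope.

Theorem mainTheorem1 (nu : seq nat) (r m : nat)
    (nu_part : is_part nu) (r_gt0 : (0 < r)%N) (m_gt0 : (0 < m)%N) :
  schur nu * power_plethysm r (complete m) =
  \sum_(la \in [set la : seq nat | is_part la /\ sumn la = (r * m + sumn nu)%N])
     schur la *~ sgn_r r la nu.
Proof.
set P := [set la | _]; have finP : finite_set P by exact: finite_part.
rewrite fsbig_finite//; set s : seq (seq nat) := fset_set P.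
have us : uniq s by exact: fset_uniq.
have sE la : (la \in s) = is_part la && (sumn la == r * m + sumn nu)%N.
  rewrite in_fset_set//; apply/idP/andP => [|[pla /eqP sla]].
    by rewrite inE => -[? /eqP].
  by rewrite inE.
apply: funext => a; rewrite series_sumE.
(* With M + 1 variables the first summand makes room for the monomial a, and the second for all
   parts of every partition in [s]. *)
pose M := (\max_(i <- a) i + (r * m + sumn nu))%N.
have a_supp i : (M < i)%N -> a i = 0%N.
  move=> Mi; apply/eqP; rewrite mset_eq0; apply: contraTN Mi => ia.
  rewrite -leqNgt /M (leq_trans _ (leq_addr _ _))//.
  exact: (@leq_bigmax_seq _ _ xpredT id).
have sub_supp b : (b `<=` a)%mset -> forall i, (M < i)%N -> b i = 0%N.
  move=> /msubsetP ba i /a_supp ai; by have := ba i; rewrite ai leqn0 => /eqP.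
transitivity ((tableau_sum M Xvar M.+1 nu * power_complete Xvar r m M.+1) a).
  apply: eq_series_mul => b /sub_supp bM; first exact: schur_tableau_sum.
  exact: power_plethysm_complete.
rewrite (tableau_sum_pieri (leqnn M) r_gt0 Xvar_sub_lreg nu_part _ us sE); last first.
  exact/leqW/leq_addl.
rewrite series_sumE; apply: eq_bigr => la _.
by rewrite !series_mulrzE (@schur_tableau_sum M M.+1 la a).
Qed.
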